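(* Let $n\ge 1$. Every Clifford transformation over $n$ qubits can be implemented over the Linear Nearest Neighbor (LNN) architecture as a circuit with two-qubit gate depth at most $7n-4$.
   Context: A Clifford transformation over $n$ qubits is a unitary on $n$ qubits generated by the Hadamard gate $H$, the Phase gate $P:|x\rangle\mapsto i^{x}|x\rangle$ and the gate $\mathrm{CNOT}:|x,y\rangle\mapsto|x,x\oplus y\rangle$ applied to arbitrary qubits or ordered pairs of qubits; as usual, implementation is understood up to a global phase. LNN architecture: the qubits are arranged on a line in positions $1,\dots,n$, and a two-qubit gate may be applied only to a pair of qubits in positions $\{k,k+1\}$, $1\le k\le n-1$ (for CNOT, with either one as control). The circuits are built from single-qubit Clifford gates (on any qubit) and CNOT and CZ gates on adjacent qubits, where $\mathrm{CZ}:|x,y\rangle\mapsto(-1)^{xy}|x,y\rangle$; no ancillary qubits are used, and the circuit must implement the given transformation without leftover permutation of the qubits. Two-qubit gate depth: the single-qubit gates are not counted; the two-qubit gate depth of a circuit is the least number $d$ such that its two-qubit gates can be arranged, compatibly with the circuit order, into $d$ consecutive layers where the two-qubit gates in one layer act on pairwise disjoint pairs of qubits (arbitrary single-qubit gates are allowed between layers). *)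

(* Defs.v *)
From mathcomp Require Import all_boot all_order all_algebra.

Set Implicit Arguments.
Unset Strict Implicit.
Unset Printing Implicit Defensive.

Import Order.TTheory GRing.Theory Num.Theory.
Local Open Scope ring_scope.

(* Computational basis states of n qubits; x k is the bit of the qubit in the
   (k+1)-th position of the line. *)
Definition bits (n : nat) := {ffun 'I_n -> bool}.

(* Operators act on column vectors: column y of U is the image of |y>. *)
Definition op (C : numClosedFieldType) (n : nat) := 'M[C]_#|{: bits n}|.

Definition op_of (C : numClosedFieldType) (n : nat)
    (K : bits n -> bits n -> C) : op C n :=
  \matrix_(i, j) K (enum_val i) (enum_val j).

Definition entry (C : numClosedFieldType) (n : nat) (U : op C n)
    (x y : bits n) : C :=
  U (enum_rank x) (enum_rank y).

Section Operators.

Variables (C : numClosedFieldType) (n : nat).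

(* |y> |-> |y_1, .., y_t (+) y_c, .., y_n>, for c != t. *)
Definition cnot (c t : 'I_n) : op C n :=
  op_of (fun x y => (x == [ffun k => if k == t then y t (+) y c else y k])%:R).

Definition cz (a b : 'I_n) : op C n :=
  op_of (fun x y => (-1) ^+ (y a && y b) *+ (x == y)).

(* The tensor product of V, acting on qubit q, with the identity on the other
   qubits. *)
Definition on_qubit (q : 'I_n) (V : op C 1) : op C n :=
  op_of (fun x y => entry V [ffun => x q] [ffun => y q]
                      *+ [forall k, (k != q) ==> (x k == y k)]).

End Operators.

Definition hadamard (C : numClosedFieldType) : op C 1 :=
  op_of (fun x y => (-1) ^+ (x ord0 && y ord0) / sqrtC 2).

Definition phase (C : numClosedFieldType) : op C 1 :=
  op_of (fun x y => 'i ^+ y ord0 *+ (x == y)).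

(* The generators have finite order, so closure under inverses is automatic. *)
Inductive clifford (C : numClosedFieldType) (n : nat) : op C n -> Prop :=
  | clifford_id : clifford 1%:M
  | clifford_H (q : 'I_n) : clifford (on_qubit q (hadamard C))
  | clifford_P (q : 'I_n) : clifford (on_qubit q (phase C))
  | clifford_CNOT (c t : 'I_n) : c != t -> clifford (cnot C c t)
  | clifford_mul (U V : op C n) :
      clifford U -> clifford V -> clifford (U *m V).

Definition adjacent (n : nat) (a b : 'I_n) : bool :=
  (a.+1 == b :> nat) || (b.+1 == a :> nat).

Inductive lnn_gate (C : numClosedFieldType) (n : nat) : Type :=
  | Single (q : 'I_n) (V : op C 1) of clifford V
  | CNOT (c t : 'I_n) of adjacent c t
  | CZ (a b : 'I_n) of adjacent a b.

Section Circuits.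

Variables (C : numClosedFieldType) (n : nat).
Implicit Types (g : lnn_gate C n) (s : seq (lnn_gate C n)).

Definition gate_op g : op C n :=
  match g with
  | Single q V _ => on_qubit q V
  | CNOT c t _ => cnot C c t
  | CZ a b _ => cz C a b
  end.

(* The head of the list is applied first. *)
Fixpoint circuit_op s : op C n :=
  if s is g :: s' then circuit_op s' *m gate_op g else 1%:M.

Definition two_qubit g : bool := if g is Single _ _ _ then false else true.

Definition qubits g : {set 'I_n} :=
  match g with
  | Single q _ _ => [set q]
  | CNOT c t _ => [set c; t]
  | CZ a b _ => [set a; b]
  end.

(* Each two-qubit gate of s is put in one of d layers by L.  Two gates that share a
   qubit stay in circuit order and may not be in the same layer, so the layer
   strictly increases; gates on disjoint pairs are unconstrained. *)
Definition layerable s (d : nat) : bool :=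
  let t := [seq g <- s | two_qubit g] in
  [exists L : {ffun 'I_(size t) -> 'I_d},
    [forall i : 'I_(size t), forall j : 'I_(size t),
       (i < j)%N && ~~ [disjoint qubits (tnth (in_tuple t) i)
                               & qubits (tnth (in_tuple t) j)]
         ==> (L i < L j)%N]].

Lemma layerable_ex s : exists d, layerable s d.
Proof.
exists (size [seq g <- s | two_qubit g]); apply/existsP.
exists [ffun i => i]; apply/forallP => i; apply/forallP => j.
by apply/implyP => /andP[ij _]; rewrite !ffunE.
Qed.

Definition two_qubit_depth s : nat := ex_minn (layerable_ex s).

End Circuits.

(* Main.v *)
Require Import Defs.
From mathcomp Require Import all_boot all_order all_algebra.
From mathcomp Require Import reals complex zify ring.

(** Idea.  Write a Clifford operator as a word w in H, P, CNOT.  Conjugation by w^-1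
    sends the Pauli operators Z_0, ..., Z_(n-1) to commuting Pauli operators.  A
    sweep of two-qubit boxes (k, k+1), k = 0, 1, ..., each consisting of at most
    two CNOT gates and some one-qubit gates, pushes the support of one Pauli
    operator to the last qubit it reaches.  Successive sweeps over the first n,
    n - 1, ... qubits can be pipelined, so in CNOT depth 4n - 4 they turn the
    family into Z-type operators whose exponents form an anti-triangular matrix b.
    The operator r that remains sends |x> to phi(x)|b x + t> with phi a quadratic
    phase.  A CNOT circuit for an anti-triangular b is odd-even transposition:
    n layers of boxes, each one a swap of two neighbours (depth 3) in which one
    CNOT is dropped when a matrix coefficient has to be cleared.  In this circuit
    each pair of wires meets exactly once, and at that moment their sum is present
    on a wire; inserting P gates there produces, by triangularity, all the phases
    (-1)^(x_i x_j).  The total depth is (4n - 4) + 3n. *)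

Set Implicit Arguments.
Unset Strict Implicit.
Unset Printing Implicit Defensive.

Import GRing.Theory Num.Theory.

(** * CNOT depth of a schedule *)

Section Depth.

Local Open Scope ring_scope.

Variable n : nat.
Implicit Types (ps : seq ('I_n * 'I_n)) (t : 'I_n -> nat).

Definition tick (p : 'I_n * 'I_n) t : 'I_n -> nat := fun k =>
  if (k == p.1) || (k == p.2) then (maxn (t p.1) (t p.2)).+1 else t k.

(* As-soon-as-possible schedule: if qubit q is busy until time t q, it is busy
   until time [finish ps t q] once the gates on the pairs ps are appended. *)
Definition finish ps t : 'I_n -> nat := foldl (fun t' p => tick p t') t ps.

Lemma finish_cat ps1 ps2 t : finish (ps1 ++ ps2) t = finish ps2 (finish ps1 t).
Proof. by rewrite /finish foldl_cat. Qed.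

Lemma tick_ge p t k : (t k <= tick p t k)%N.
Proof.
rewrite /tick; case: ifP => // /orP[] /eqP ->; apply: leqW.
  exact: leq_maxl.
exact: leq_maxr.
Qed.

Lemma finish_ge ps t k : (t k <= finish ps t k)%N.
Proof.
elim: ps t => [|p ps IH] t //=.
exact: leq_trans (tick_ge p t k) (IH _).
Qed.

(** The layer of a gate is the time at which both of its qubits become free. The bound [t q <= L i]
    carries the induction: applied after the first gate, it puts later gates on a shared qubit into
    strictly later layers. *)
Lemma finish_layers ps t d : (forall q, finish ps t q <= d)%N ->
  exists L : nat -> nat,
    (forall i, i < size ps -> L i < d)%N /\
    forall p0,
    (forall i q, (i < size ps)%N ->
       (q == (nth p0 ps i).1) || (q == (nth p0 ps i).2) -> (t q <= L i)%N) /\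
    (forall i j q, (i < j)%N -> (j < size ps)%N ->
       (q == (nth p0 ps i).1) || (q == (nth p0 ps i).2) ->
       (q == (nth p0 ps j).1) || (q == (nth p0 ps j).2) -> (L i < L j)%N).
Proof.
elim: ps t => [|p ps IH] t bnd; first by exists (fun _ => 0%N).
have [L [Ld HL]] := IH _ bnd.
pose m := maxn (t p.1) (t p.2).
exists (fun i => if i is i'.+1 then L i' else m); split.
  case=> [_|i]; last by rewrite /= ltnS; exact: Ld.
  apply: leq_trans (bnd p.1).
  by apply: leq_trans (finish_ge ps (tick p t) p.1); rewrite /tick eqxx.
move=> p0; have [L1 L2] := HL p0; split.
  case=> [|i] q /=.
    by move=> _ /orP[] /eqP ->; rewrite /m; [exact: leq_maxl | exact: leq_maxr].
  by rewrite ltnS => ilt qi; exact: leq_trans (tick_ge p t q) (L1 _ _ ilt qi).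
case=> [|i] [|j] q //=; last by rewrite !ltnS; exact: L2.
rewrite ltnS => _ jlt q0 qj.
by apply: leq_trans (L1 _ _ jlt qj); rewrite /tick q0.
Qed.

Definition pair_set (p : 'I_n * 'I_n) : {set 'I_n} := [set p.1; p.2].

Lemma depth_le (C : numClosedFieldType) (s : seq (lnn_gate C n)) ps d :
  [seq qubits g | g <- s & two_qubit g] = [seq pair_set p | p <- ps] ->
  (forall q, finish ps (fun=> 0%N) q <= d)%N -> (two_qubit_depth s <= d)%N.
Proof.
move=> eqs /finish_layers[L [Ld HL]].
rewrite /two_qubit_depth; case: ex_minnP => m _; apply.
rewrite /layerable; set u := [seq g <- s | two_qubit g].
have su : size u = size ps by rewrite -(size_map pair_set) -eqs size_map.
have Lu (i : 'I_(size u)) : (L i < d)%N by apply: Ld; rewrite -su.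
apply/existsP; exists [ffun i => Ordinal (Lu i)].
apply/forallP => i; apply/forallP => j; apply/implyP => /andP[ij].
rewrite !ffunE /=.
(* A default for [nth]; [ps] is nonempty because [i] indexes one of its gates. *)
have p0 : 'I_n * 'I_n.
  case: (ps) su => [|p //]; case: (u) i {j ij Lu} => [[]|]//.
have [_ L2] := HL p0.
have tn (k : 'I_(size u)) :
    qubits (tnth (in_tuple u) k) = pair_set (nth p0 ps k).
  rewrite (tnth_nth (tnth (in_tuple u) k)) /=.
  rewrite -(nth_map _ (pair_set p0) pair_set) -?su // -eqs.
  by rewrite (nth_map (tnth (in_tuple u) k)).
rewrite !tn -setI_eq0 => /set0Pn[q]; rewrite !inE => /andP[qi qj].
by apply: (L2 i j q) => //; rewrite -su.
Qed.

End Depth.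

(** * Pauli operators and their images under Clifford gates *)

Section Bits.

Local Open Scope ring_scope.

Variable n : nat.
Implicit Types (x y a b : bits n) (k q c t : 'I_n).

Lemma bitsD x y k : (x + y) k = x k (+) y k. Proof. by rewrite ffunE. Qed.

Lemma bits0 k : (0 : bits n) k = false. Proof. by rewrite ffunE. Qed.

Lemma bitsDD x : x + x = 0.
Proof. by apply/ffunP => k; rewrite bitsD addbb bits0. Qed.

Lemma bitsK a : involutive (fun x => x + a).
Proof. by move=> x; rewrite -addrA bitsDD addr0. Qed.

(** The sum is taken in [bool] viewed as the field with two elements. *)
Definition dot b x : bool := \sum_k (b k * x k : bool).

Lemma dotC b x : dot b x = dot x b.
Proof. by apply: eq_bigr => k _; rewrite mulrC. Qed.

Lemma dotDr b x y : dot b (x + y) = dot b x (+) dot b y.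
Proof.
rewrite -[RHS]/(dot b x + dot b y) /dot -big_split.
by apply: eq_bigr => k _; rewrite ffunE mulrDr.
Qed.

Lemma dot0 b : dot b 0 = false.
Proof. by rewrite /dot big1 // => k _; rewrite bits0 mulr0. Qed.

Lemma dot0l b : dot 0 b = false. Proof. by rewrite dotC dot0. Qed.

Definition unit_bits q : bits n := [ffun k => k == q].

Lemma dot_unit b q : dot b (unit_bits q) = b q.
Proof.
rewrite /dot (bigD1 q) //= ffunE eqxx mulr1 big1 ?addr0 // => k /negPf kq.
by rewrite ffunE kq mulr0.
Qed.

Definition rest_dot q b x : bool := \sum_(k | k != q) (b k * x k : bool).

Lemma dotD1 q b x : dot b x = (b q && x q) (+) rest_dot q b x.
Proof. by rewrite /dot (bigD1 q). Qed.

Lemma eq_rest_dot q b b' x x' : {in predC1 q, b =1 b'} ->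
  {in predC1 q, x =1 x'} -> rest_dot q b x = rest_dot q b' x'.
Proof. by move=> eb ex; apply: eq_bigr => k kq; rewrite eb ?ex. Qed.

Lemma dotD2 q q' b x : q != q' ->
  dot b x = (b q && x q) (+) ((b q' && x q') (+)
    (\sum_(k | (k != q) && (k != q')) (b k * x k : bool))).
Proof. by move=> qq; rewrite /dot (bigD1 q) // (bigD1 q') // eq_sym. Qed.

Definition cnotf c t x : bits n :=
  [ffun k => if k == t then x t (+) x c else x k].

Lemma cnotfK c t : c != t -> involutive (cnotf c t).
Proof.
move=> ct x; apply/ffunP => k; rewrite !ffunE eqxx (negPf ct).
by case: eqP => [->|//]; rewrite addbK.
Qed.

Lemma cnotfD c t x y : cnotf c t (x + y) = cnotf c t x + cnotf c t y.
Proof.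
apply/ffunP => k; rewrite bitsD !ffunE; case: eqP => // _.
by case: (x t); case: (x c); case: (y t); case: (y c).
Qed.

(** A CNOT with exchanged roles is the inverse transpose of the CNOT on bit vectors. *)
Lemma dot_cnotf c t b x :
  c != t -> dot (cnotf t c b) (cnotf c t x) = dot b x.
Proof.
move=> ct; rewrite !(dotD2 _ _ ct) !ffunE !eqxx (negPf ct) eq_sym (negPf ct).
rewrite [X in _ (+) (_ (+) X)](_ : _ =
  \sum_(k | (k != c) && (k != t)) (b k * x k : bool)).
  move: (\sum_(k | _) _) => [];
    by case: (b t); case: (b c); case: (x t); case: (x c).
by apply: eq_bigr => k /andP[/negPf kc /negPf kt]; rewrite !ffunE kc kt.
Qed.

End Bits.

(* (a, b) stands for the Pauli operator |y> |-> (-1)^(b . y) |y + a>. *)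
Definition pauli n : Type := (bits n * bits n)%type.

Inductive gen (n : nat) : Type :=
  | GH of 'I_n
  | GP of 'I_n
  | GC of 'I_n & 'I_n.

(** * Symplectic action of words on Pauli operators modulo phase *)

Section Tableau.

Local Open Scope ring_scope.

Variable n : nat.
Implicit Types (g : gen n) (s : seq (gen n)) (v w : pauli n) (q : 'I_n).

Definition wf_gen g := if g is GC c t then c != t else true.

Definition swapat q (x y : bits n) : bits n :=
  [ffun k => if k == q then y k else x k].

(** This is conjugation by the generator with the scalar factor forgotten; P turns X into XZ up to
    such a factor. *)
Definition gact g v : pauli n :=
  match g with
  | GH q => (swapat q v.1 v.2, swapat q v.2 v.1)
  | GP q => (v.1, [ffun k => v.2 k (+) ((k == q) && v.1 k)])
  | GC c t => (cnotf c t v.1, cnotf t c v.2)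
  end.

Definition act s v : pauli n := foldl (fun v' g => gact g v') v s.

Lemma act_cat s1 s2 v : act (s1 ++ s2) v = act s2 (act s1 v).
Proof. by rewrite /act foldl_cat. Qed.

(** The symplectic form detects commutation: false for commuting Pauli operators, true for
    anticommuting ones. *)
Definition sympl v w : bool := dot v.1 w.2 (+) dot v.2 w.1.

Lemma gactK g : wf_gen g -> involutive (gact g).
Proof.
case: g => [q|q|c t] wf [a b] /=; congr pair; last first.
- by apply: cnotfK; rewrite eq_sym.
- exact: cnotfK.
all: apply/ffunP => k; rewrite !ffunE //; try by case: eqP.
by case: eqP => _; rewrite /= ?addbF // -addbA addbb addbF.
Qed.

Lemma gact_sympl g v w : wf_gen g -> sympl (gact g v) (gact g w) = sympl v w.
Proof.
case: g v w => [q|q|c t] [a b] [a' b'] wf /=; rewrite /sympl /=.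
- rewrite !(dotD1 q) !ffunE !eqxx.
  rewrite (@eq_rest_dot _ _ (swapat q a b) a (swapat q b' a') b');
    try by move=> k /negPf kq; rewrite ffunE kq.
  rewrite (@eq_rest_dot _ _ (swapat q b a) b (swapat q a' b') a');
    try by move=> k /negPf kq; rewrite ffunE kq.
  by case: (rest_dot _ _ _); case: (rest_dot _ _ _);
    case: (a q); case: (a' q); case: (b q); case: (b' q).
- rewrite !(dotD1 q) !ffunE !eqxx.
  rewrite (@eq_rest_dot _ _ a a [ffun k => _] b') //;
    try by move=> k /negPf kq; rewrite ffunE kq addbF.
  rewrite (@eq_rest_dot _ _ [ffun k => _] b a' a') //;
    try by move=> k /negPf kq; rewrite ffunE kq addbF.
  by case: (rest_dot _ _ _); case: (rest_dot _ _ _);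
    case: (a q); case: (a' q); case: (b q); case: (b' q).
- by rewrite (dotC (cnotf c t a)) !dot_cnotf // dotC.
Qed.

Lemma act_sympl s v w : all wf_gen s -> sympl (act s v) (act s w) = sympl v w.
Proof.
elim: s v w => [|g s IH] v w //= /andP[wg ws].
by rewrite IH // gact_sympl.
Qed.

(** As an operator P has order four, so its inverse is its cube, although its action modulo phase is
    an involution. *)
Definition ginv g : seq (gen n) := if g is GP q then [:: g; g; g] else [:: g].

Definition inv s : seq (gen n) := flatten [seq ginv g | g <- rev s].

Lemma inv_cons g s : inv (g :: s) = inv s ++ ginv g.
Proof. by rewrite /inv rev_cons map_rcons flatten_rcons. Qed.

Lemma wf_inv s : all wf_gen s -> all wf_gen (inv s).
Proof.
elim: s => [|g s IH] //= /andP[wg ws]; rewrite inv_cons all_cat IH //=.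
by case: g wg => //= c t ->.
Qed.

Lemma act_inv s : all wf_gen s -> cancel (act s) (act (inv s)).
Proof.
elim: s => [|g s IH] //= /andP[wg ws] v; rewrite inv_cons act_cat IH //.
have gK := gactK wg; case: g {wg} gK => [q|q|c t] gK; [exact: gK | | exact: gK].
by rewrite -[LHS]/(gact _ (gact _ (gact _ (gact _ v)))) !gK.
Qed.

Lemma act_invr s : all wf_gen s -> cancel (act (inv s)) (act s).
Proof. by move/act_inv/canF_sym. Qed.

End Tableau.

Arguments wf_gen {n} g.

(** * Matrix entries and products with monomial operators *)

Section Entries.

Local Open Scope ring_scope.

Variables (C : numClosedFieldType) (n : nat).
Implicit Types (A B : op C n) (x y z : bits n).

Lemma entry_of K x y : entry (op_of K : op C n) x y = K x y.
Proof. by rewrite /entry mxE !enum_rankK. Qed.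

Lemma eq_entry A B : (forall x y, entry A x y = entry B x y) -> A = B.
Proof.
move=> e; apply/matrixP => i j.
by rewrite -(enum_valK i) -(enum_valK j); exact: e.
Qed.

Lemma entryZ c A x y : entry (c *: A) x y = c * entry A x y.
Proof. by rewrite /entry mxE. Qed.

Lemma entry1 x y : entry (1%:M : op C n) x y = (x == y)%:R.
Proof. by rewrite /entry mxE (inj_eq enum_rank_inj). Qed.

Lemma entryM A B x y :
  entry (A *m B) x y = \sum_z entry A x z * entry B z y.
Proof.
rewrite /entry mxE (reindex (@enum_rank (bits n))) //.
exact: (onW_bij _ (@enum_rank_bij _)).
Qed.

Lemma entry_mul_mono A B f (p : bits n -> C) x y :
  (forall z, entry B z y = p y *+ (z == f y)) ->
  entry (A *m B) x y = entry A x (f y) * p y.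
Proof.
move=> eB; rewrite entryM (bigD1 (f y)) //= eB eqxx mulr1n big1 ?addr0 //.
by move=> z /negPf zf; rewrite eB zf mulr0n mulr0.
Qed.

Lemma entry_mono_mul A B f f' (p : bits n -> C) x y :
  (forall z, entry A x z = p z *+ (x == f z)) -> cancel f f' -> cancel f' f ->
  entry (A *m B) x y = p (f' x) * entry B (f' x) y.
Proof.
move=> eA fK fK'; rewrite entryM (bigD1 (f' x)) //= eA fK' eqxx mulr1n.
rewrite big1 ?addr0 // => z zf; rewrite eA.
by case: eqP => [xz|_]; [rewrite xz fK eqxx in zf | rewrite mul0r].
Qed.

End Entries.

Section Evaluation.

Local Open Scope ring_scope.

Variables (C : numClosedFieldType) (n : nat).
Implicit Types (A B : op C n) (g : gen n) (s : seq (gen n)) (v w : pauli n).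
Implicit Types (x y z : bits n) (q : 'I_n).

Definition gop g : op C n :=
  match g with
  | GH q => on_qubit q (hadamard C)
  | GP q => on_qubit q (phase C)
  | GC c t => cnot C c t
  end.

Fixpoint eval s : op C n := if s is g :: s' then eval s' *m gop g else 1%:M.

Lemma eval_cat s1 s2 : eval (s1 ++ s2) = eval s2 *m eval s1.
Proof. by elim: s1 => [|g s IH] /=; rewrite ?mulmx1 // IH mulmxA. Qed.

Definition pauli_op v : op C n :=
  op_of (fun x y => (-1) ^+ dot v.2 y *+ (x == y + v.1)).

Lemma entry_H q x y : entry (gop (GH q)) x y =
  (-1) ^+ (x q && y q) / sqrtC 2 *+ [forall k, (k != q) ==> (x k == y k)].
Proof. by rewrite /= /on_qubit /hadamard !entry_of !ffunE. Qed.

Lemma entry_P q x y : entry (gop (GP q)) x y = 'i ^+ y q *+ (x == y).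
Proof.
rewrite /= /on_qubit /phase !entry_of !ffunE -mulrnA mulnb; congr (_ *+ _).
congr nat_of_bool; apply/andP/eqP => [[/eqP xy /forallP e]|->]; last first.
  by split=> //; apply/forallP => k; rewrite eqxx implybT.
apply/ffunP => k; case: (eqVneq k q) => [->|kq].
  by move/ffunP: xy => /(_ ord0); rewrite !ffunE.
by have := e k; rewrite kq => /eqP.
Qed.

Lemma entry_C c t x y : entry (gop (GC c t)) x y = (x == cnotf c t y)%:R.
Proof. by rewrite /= /cnot entry_of. Qed.

Lemma entry_pauli v x y :
  entry (pauli_op v) x y = (-1) ^+ dot v.2 y *+ (x == y + v.1).
Proof. exact: entry_of. Qed.

Lemma entry_mul_pauli A v x y :
  entry (A *m pauli_op v) x y = entry A x (y + v.1) * (-1) ^+ dot v.2 y.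
Proof.
by apply: (entry_mul_mono _ (p := fun y => (-1) ^+ dot v.2 y)
             (f := fun y => y + v.1)) => z; exact: entry_pauli.
Qed.

Lemma entry_pauli_mul A v x y :
  entry (pauli_op v *m A) x y = (-1) ^+ dot v.2 (x + v.1) * entry A (x + v.1) y.
Proof.
apply: (entry_mono_mul _ _ (p := fun y => (-1) ^+ dot v.2 y)
          (f := fun y => y + v.1) (f' := fun y => y + v.1));
  by [move=> z; exact: entry_pauli | exact: bitsK].
Qed.

Lemma gop_pauli g v : wf_gen g -> exists p : nat,
  gop g *m pauli_op v = 'i ^+ p *: (pauli_op (gact g v) *m gop g).
Proof.
case: g v => [q|q|c t] [a b] wf.
(* H exchanges X and Z; restoring their order costs a sign, that is i^2, when both are present at
   q. *)
- exists (a q && b q).*2; apply: eq_entry => x y.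
  rewrite entryZ entry_mul_pauli entry_pauli_mul !entry_H /=.
  have -> : [forall k, (k != q) ==> (x k == (y + a) k)] =
      [forall k, (k != q) ==> ((x + swapat q a b) k == y k)].
    apply: eq_forallb => k; case: (eqVneq k q) => [->//|kq] /=.
    rewrite !bitsD ffunE (negPf kq).
    by case: (x k); case: (y k); case: (a k).
  case: forallP => [e|_]; last by rewrite !mulr0n mul0r !mulr0.
  rewrite !mulr1n !(dotD1 q) !bitsD !ffunE !eqxx.
  rewrite (@eq_rest_dot _ _ (swapat q b a) b (x + swapat q a b) y);
    last first.
  + by move=> k; rewrite inE => kq; move: (e k); rewrite kq => /eqP.
  + by move=> k /negPf kq; rewrite ffunE kq.
  rewrite -mul2n exprM sqrCi !signr_addb mulrAC !mulrA -!signr_addb.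
  congr (_ / _); congr (_ ^+ nat_of_bool _).
  by case: (rest_dot _ _ _); case: (a q); case: (b q); case: (x q); case: (y q).
(* On qubit q, P X = i X Z P. *)
- exists (a q : nat); apply: eq_entry => x y.
  rewrite entryZ entry_mul_pauli entry_P.
  rewrite (entry_mul_mono (f := id) _ _ (p := fun y => 'i ^+ y q)); last first.
    by move=> z; exact: entry_P.
  rewrite entry_pauli /= bitsD; case: eqP => _; last first.
    by rewrite !mulr0n !mul0r mulr0.
  rewrite !mulr1n !(dotD1 q) ffunE eqxx.
  rewrite (@eq_rest_dot _ _ [ffun k => _] b y y) //; last first.
    by move=> k /negPf kq; rewrite ffunE kq addbF.
  have i2 : 'i * 'i = -1 :> C by rewrite -expr2 sqrCi.
  rewrite !signr_addb.
  case: (rest_dot _ _ _);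
    case: (a q); case: (b q); case: (y q); rewrite /= ?expr0 ?expr1;
    by ring: i2.
- exists 0%N; apply: eq_entry => x y.
  rewrite expr0 scale1r entry_mul_pauli entry_C.
  rewrite (entry_mul_mono (f := cnotf c t) _ _ (p := fun y => 1)); last first.
    by move=> z; exact: entry_C.
  rewrite entry_pauli /= -cnotfD dot_cnotf // mulr1.
  by case: eqP; rewrite ?mulr1n ?mulr0n ?mul1r ?mul0r.
Qed.

Lemma eval_pauli s v : all wf_gen s -> exists p : nat,
  eval s *m pauli_op v = 'i ^+ p *: (pauli_op (act s v) *m eval s).
Proof.
elim: s v => [|g s IH] v /=; first by exists 0%N; rewrite mulmx1 mul1mx scale1r.
case/andP=> wg ws; have [p1 e1] := gop_pauli v wg.
have [p2 e2] := IH (gact g v) ws.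
exists (p1 + p2)%N; rewrite -mulmxA e1 -scalemxAr !mulmxA e2 -scalemxAl.
by rewrite scalerA exprD.
Qed.

End Evaluation.

(** * Inverses and global phases *)

Section Words.

Local Open Scope ring_scope.

Variables (C : numClosedFieldType) (n : nat).
Implicit Types (A B : op C n) (g : gen n) (s : seq (gen n)) (v w : pauli n).
Implicit Types (x y z : bits n) (q t : 'I_n).

Lemma clifford_eval (U : op C n) :
  clifford U -> exists2 w, all wf_gen w & U = eval C w.
Proof.
elim=> [|q|q|c t ct|V W _ [s ws ->] _ [s' ws' ->]].
- by exists [::].
- by exists [:: GH q]; rewrite //= mul1mx.
- by exists [:: GP q]; rewrite //= mul1mx.
- by exists [:: GC c t]; rewrite /= ?ct // mul1mx.
- by exists (s' ++ s); rewrite ?all_cat ?ws ?ws' // eval_cat.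
Qed.

Definition agree q x y := [forall k, (k != q) ==> (x k == y k)].

Lemma agree_cases q x y : agree q x y -> y = x \/ y = x + unit_bits q.
Proof.
move=> /forallP e; have exy : forall k, k != q -> x k = y k.
  by move=> k kq; move: (e k); rewrite kq => /eqP.
case: (boolP (x q == y q)) => xy; [left | right]; apply/ffunP => k.
  by case: (eqVneq k q) => [->|/exy //]; rewrite (eqP xy).
rewrite bitsD ffunE; case: (eqVneq k q) => [->|/exy ->]; last by rewrite addbF.
by move: xy; case: (x q); case: (y q).
Qed.

Lemma gopHK q : gop C (GH q) *m gop C (GH q) = 1%:M.
Proof.
have nq x : x + unit_bits q != x.
  apply/eqP => /ffunP/(_ q); rewrite bitsD ffunE eqxx addbT.
  by case: (x q).
have s2 : sqrtC 2 * sqrtC 2 = 2 :> C by rewrite -expr2 sqrtCK.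
have s0 : sqrtC 2 != 0 :> C by rewrite sqrtC_eq0 pnatr_eq0.
apply: eq_entry => x y; rewrite entryM entry1.
(* Only x and x with bit q flipped contribute as intermediate states. *)
rewrite (bigD1 x) //= (bigD1 (x + unit_bits q)) //= big1 ?addr0; last first.
  move=> z /andP[zx zxq]; rewrite entry_H.
  case: (boolP [forall k, (k != q) ==> (x k == z k)]) => [/agree_cases[] e|];
    last by rewrite mulr0n mul0r.
    by rewrite e eqxx in zx.
  by rewrite e eqxx in zxq.
rewrite !entry_H.
have -> : [forall k, (k != q) ==> (x k == x k)].
  by apply/forallP => k; rewrite eqxx implybT.
have -> : [forall k, (k != q) ==> (x k == (x + unit_bits q) k)].
  by apply/forallP => k; rewrite bitsD ffunE; case: (k == q); rewrite ?addbF /=.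
have -> : [forall k, (k != q) ==> ((x + unit_bits q) k == y k)] =
          [forall k, (k != q) ==> (x k == y k)].
  by apply: eq_forallb => k; rewrite bitsD ffunE; case: (k == q); rewrite ?addbF.
have h2 : (sqrtC 2)^-1 * (sqrtC 2)^-1 = 2^-1 :> C by rewrite -invfM s2.
have half : 2^-1 + 2^-1 = 1 :> C.
  by field.
rewrite !bitsD ffunE eqxx !mulr1n.
case: (boolP [forall k, _]) => [/agree_cases[] ->|].
- rewrite eqxx !mulr1n; case: (x q); rewrite /= ?expr0 ?expr1; ring: h2 half.
- rewrite eq_sym (negPf (nq x)) bitsD ffunE eqxx !mulr1n.
  by case: (x q); rewrite /= ?expr0 ?expr1; ring: h2 half.
- case: eqP => [->|_]; last by rewrite !mulr0n !mulr0 addr0.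
  by case/negP; apply/forallP => k; rewrite eqxx implybT.
Qed.

Lemma gopCK (c t : 'I_n) : c != t -> gop C (GC c t) *m gop C (GC c t) = 1%:M.
Proof.
move=> ct; apply: eq_entry => x y; rewrite entry1.
rewrite (entry_mul_mono (f := cnotf c t) _ _ (p := fun y => 1)); last first.
  by move=> z; exact: entry_C.
by rewrite mulr1 entry_C cnotfK.
Qed.

Lemma gopPP q : gop C (GP q) *m gop C (GP q) = pauli_op C (0, unit_bits q).
Proof.
apply: eq_entry => x y; rewrite entry_pauli /= addr0.
rewrite (entry_mul_mono (f := id) _ _ (p := fun y => 'i ^+ y q)); last first.
  by move=> z; exact: entry_P.
rewrite entry_P dotC dot_unit mulrnAl; congr (_ *+ _).
by case: (y q); rewrite /= ?expr0 ?mulr1 // !expr1 -expr2 sqrCi.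
Qed.

Lemma pauli_op0 : pauli_op C (0 : pauli n) = 1%:M.
Proof.
by apply: eq_entry => x y; rewrite entry_pauli entry1 dot0l expr0 /= addr0.
Qed.

Lemma gopP4 q : gop C (GP q) *m (gop C (GP q) *m (gop C (GP q) *m gop C (GP q)))
   = 1%:M.
Proof.
rewrite !mulmxA -mulmxA gopPP -pauli_op0.
apply: eq_entry => x y; rewrite entry_mul_pauli !entry_pauli /= addr0.
rewrite dot0l expr0 mulrnAl; congr (_ *+ _); last by rewrite addr0.
by rewrite -signr_addb addbb.
Qed.

Lemma eval_ginv g : wf_gen g -> eval C (ginv g) *m gop C g = 1%:M.
Proof.
case: g => [q|q|c t] wf; rewrite /ginv /= ?mul1mx.
- exact: gopHK.
- by rewrite -!mulmxA gopP4.
- exact: gopCK.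
Qed.

Lemma eval_inv s : all wf_gen s -> eval C (inv s) *m eval C s = 1%:M.
Proof.
elim: s => [|g s IH] /=; first by rewrite mulmx1.
case/andP=> wg ws; rewrite inv_cons eval_cat mulmxA -(mulmxA _ (eval C (inv s))).
by rewrite IH // mulmx1 eval_ginv.
Qed.

Lemma eval_unit s : all wf_gen s -> eval C s \in unitmx.
Proof. by move/eval_inv/mulmx1_unit => []. Qed.

(** A generator has finite order, so its determinant is a root of unity. *)
Lemma norm_det_gop g : wf_gen g -> `|\det (gop C g)| = 1.
Proof.
have norm1 (x : C) k : x ^+ k.+1 = 1 -> `|x| = 1.
  move=> xk; apply/eqP; rewrite -(pexpr_eq1 (n := k.+1)) //.
  by rewrite -normrX xk normr1.
case: g => [q|q|c t] wf.
- by apply: (norm1 _ 1%N); rewrite expr2 -det_mulmx gopHK det1.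
- by apply: (norm1 _ 3%N); rewrite !exprS expr0 mulr1 -!det_mulmx gopP4 det1.
- by apply: (norm1 _ 1%N); rewrite expr2 -det_mulmx gopCK // det1.
Qed.

Lemma norm_det_eval s : all wf_gen s -> `|\det (eval C s)| = 1.
Proof.
elim: s => [|g s IH] /=; first by rewrite det1 normr1.
by case/andP=> wg /IH e; rewrite det_mulmx normrM e norm_det_gop // mulr1.
Qed.

(** Comparing determinants gives |c|^N = 1, where N is the positive dimension of the state space. *)
Lemma norm_global_phase c s s' : all wf_gen s -> all wf_gen s' ->
  eval C s = c *: eval C s' -> `|c| = 1.
Proof.
move=> ws ws' /(congr1 (fun A => `|\det A|)).
rewrite detZ normrM !norm_det_eval // mulr1 normrX => /esym/eqP.
have : (0 < #|{: bits n}|)%N by apply/card_gt0P; exists 0.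
by case: #|_| => // N _; rewrite pexpr_eq1 // => /eqP.
Qed.

Definition lnn g := if g is GC c t then adjacent c t else true.

Lemma lnn_wf g : lnn g -> wf_gen g.
Proof.
case: g => //= c t; rewrite /adjacent; case: (eqVneq c t) => // ->.
by case/orP=> /eqP; lia.
Qed.

Lemma lnn_all_wf s : all lnn s -> all wf_gen s.
Proof. exact/sub_all/lnn_wf. Qed.

Definition cnots s : seq ('I_n * 'I_n) :=
  pmap (fun g => if g is GC c t then Some (c, t) else None) s.

Lemma cnots_cat s1 s2 : cnots (s1 ++ s2) = cnots s1 ++ cnots s2.
Proof. exact: pmap_cat. Qed.

(** The gate [Single] wants a Clifford operator on one qubit; [clifford_H] and [clifford_P] provide
    it only in the form [on_qubit ord0 V]. *)
Lemma on_qubit1 (V : op C 1) : on_qubit ord0 V = V.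
Proof.
apply: eq_entry => x y; rewrite entry_of.
have e (z : bits 1) : [ffun => z ord0] = z.
  by apply/ffunP => k; rewrite ffunE (ord1 k).
rewrite !e (_ : [forall k, _]) //.
by apply/forallP => k; rewrite (ord1 k).
Qed.

Lemma lnn_circuit s : all lnn s -> exists s' : seq (lnn_gate C n),
  circuit_op s' = eval C s /\
  [seq qubits h | h <- s' & two_qubit h] = [seq pair_set p | p <- cnots s].
Proof.
elim: s => [|g s IH] /=; first by exists [::].
case/andP=> lg /IH[s' [e1 e2]]; case: g lg => [q|q|c t] lg.
- exists (Single q (clifford_H C ord0) :: s'); split; last exact: e2.
  by rewrite /= e1 on_qubit1.
- exists (Single q (clifford_P C ord0) :: s'); split; last exact: e2.
  by rewrite /= e1 on_qubit1.
- by exists (CNOT C lg :: s'); rewrite /= e1 e2.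
Qed.

End Words.
Arguments lnn {n} g.

(** * Localizing commuting Pauli operators by sweeps *)

Section Sweeps.

Local Open Scope ring_scope.

Variable n : nat.
Implicit Types (s : seq (gen n)) (v w : pauli n) (p q k i m : 'I_n).
Implicit Types (t : 'I_n -> nat) (D : nat).

Definition supp v k := v.1 k || v.2 k.

Definition same_at v w k := (v.1 k = w.1 k) /\ (v.2 k = w.2 k).

Lemma same_at_refl v k : same_at v v k. Proof. by []. Qed.

Lemma same_at_trans v1 v2 v3 k :
  same_at v1 v2 k -> same_at v2 v3 k -> same_at v1 v3 k.
Proof. by rewrite /same_at => -[-> ->]. Qed.

Lemma same_at_supp v w k : same_at v w k -> supp v k = supp w k.
Proof. by rewrite /supp => -[-> ->]. Qed.

Definition gen_le m (g : gen n) : bool :=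
  match g with
  | GH q => (q <= m)%N
  | GP q => (q <= m)%N
  | GC c c' => (c <= m)%N && (c' <= m)%N
  end.

Lemma gen_le_trans m m' s :
  (m <= m')%N -> all (gen_le m) s -> all (gen_le m') s.
Proof.
by move=> mm; apply: sub_all => -[q|q|c t] /=; move: mm; lia.
Qed.

Lemma act_above m s v k :
  all (gen_le m) s -> (m < k)%N -> same_at (act s v) v k.
Proof.
move=> + mk; elim: s v => [|g s IH] v //= /andP[gm /IH-/(_ (gact g v)) sm].
apply: (same_at_trans sm).
have ne q : (q <= m)%N -> (k == q) = false by rewrite -val_eqE /=; move: mk; lia.
by case: g gm {sm} => [q|q|c t] /= => [qm|qm|/andP[cm tm]];
  split; rewrite //= ffunE ne ?addbF.
Qed.

(** This is what protects the operators already treated from the shorter sweeps that follow. *)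
Lemma act_trivial m s v : all (gen_le m) s ->
  (forall k, (k <= m)%N -> supp v k = false) -> act s v = v.
Proof.
move=> + v0; elim: s => [|g s IH] //= /andP[gm sm].
rewrite /act /= -[RHS](IH sm); congr foldl.
have v1 k : (k <= m)%N -> v.1 k = false by move/v0; rewrite /supp; case: (v.1 k).
have v2 k : (k <= m)%N -> v.2 k = false.
  by move/v0; rewrite /supp orbC; case: (v.2 k).
case: v v1 v2 {v0 IH} => a b /= a0 b0.
case: g gm => [q|q|c t] /= gm; congr pair; apply/ffunP => k; rewrite !ffunE //;
  case: eqP => [->|//]; rewrite ?addbF //.
- by rewrite a0 ?b0.
- by rewrite a0 ?b0.
- by rewrite (a0 q) // addbF.
- by case/andP: gm => cm tm; rewrite !a0.
- by case/andP: gm => cm tm; rewrite !b0.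
Qed.

(** Y is first turned into X by P, and H turns X into Z. *)
Definition to_Z v q : seq (gen n) :=
  if v.1 q then (if v.2 q then [:: GP q; GH q] else [:: GH q]) else [::].

Lemma cnots_to_Z v q : cnots (to_Z v q) = [::].
Proof. by rewrite /to_Z; case: ifP => // _; case: ifP. Qed.

Lemma lnn_to_Z v q : all lnn (to_Z v q).
Proof. by rewrite /to_Z; case: ifP => // _; case: ifP. Qed.

Lemma le_to_Z v q : all (gen_le q) (to_Z v q).
Proof. by rewrite /to_Z; case: ifP => // _; case: ifP => _ /=; rewrite leqnn. Qed.

Lemma act_to_Z v w q : same_at w v q -> supp v q ->
  (act (to_Z v q) w).1 q = false /\ (act (to_Z v q) w).2 q = true.
Proof.
case: w => a b [/= ea eb]; rewrite /supp /to_Z /act.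
by case: (boolP (v.1 q)) => v1; case: (boolP (v.2 q)) => v2 //= _;
  rewrite ?ffunE ?eqxx ea eb ?(negPf v1) ?(negPf v2) ?v1 ?v2.
Qed.

Lemma act_to_Z_other v w q k : k != q -> same_at (act (to_Z v q) w) w k.
Proof.
move=> /negPf kq; rewrite /to_Z /act; case: ifP => _; last by [].
by case: ifP => _; split; rewrite /= ?ffunE ?kq ?addbF.
Qed.

Lemma box_sweep v p q : q = p.+1 :> nat -> exists s,
  [/\ all lnn s, all (gen_le q) s,
   forall t k, (finish (cnots s) t k <=
     if (k == p) || (k == q) then maxn (t p) (t q) + 2 else t k)%N,
   supp (act s v) p = false /\ (supp v p || supp v q -> supp (act s v) q) &
   forall k, k != p -> k != q -> same_at (act s v) v k].
Proof.
move=> qp; have pq : p != q by rewrite -val_eqE /= qp; lia.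
have qp' : q != p by rewrite eq_sym.
case: (boolP (supp v p)) => [vp|vp]; last first.
  exists [::]; split=> //=.
    move=> t k; case: ifP => // /orP[] /eqP ->;
      by apply: leq_trans (leq_addr _ _); rewrite ?leq_maxl ?leq_maxr.
  by split=> //; exact: negPf.
have pleq : (p <= q)%N by rewrite qp.
pose w1 := act (to_Z v p) v.
have [w1p1 w1p2] := act_to_Z (same_at_refl v p) vp.
have w1o k : k != p -> same_at w1 v k by exact: act_to_Z_other.
case: (boolP (supp v q)) => vq.
  (* Both qubits carry Z after the rotations, and one CNOT turns ZZ into Z on q alone. *)
  pose s := to_Z v p ++ to_Z v q ++ [:: GC p q].
  pose w2 := act (to_Z v q) w1.
  have sE : act s v = gact (GC p q) w2 by rewrite /s !act_cat.
  have [w2q1 w2q2] := act_to_Z (w1o q qp') vq.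
  have [w2p1 w2p2] := act_to_Z_other v w1 pq.
  have cE : cnots s = [:: (p, q)] by rewrite !cnots_cat !cnots_to_Z.
  exists s; split.
  - by rewrite !all_cat !lnn_to_Z /= /adjacent qp eqxx.
  - by rewrite !all_cat le_to_Z (gen_le_trans pleq (le_to_Z _ _)) /= pleq leqnn.
  - by move=> t k; rewrite cE /= /tick /=; case: (_ || _) => //; rewrite addn2.
  - rewrite sE /supp /= !ffunE !eqxx (negPf pq) (negPf qp').
    by rewrite w2p1 w2p2 w1p1 w1p2 w2q1 w2q2.
  - move=> k /negPf kp /negPf kq; rewrite sE.
    have [e1 e2] := act_to_Z_other v w1 (negbT kq).
    have [e3 e4] := w1o k (negbT kp).
    by split; rewrite /= !ffunE ?kp ?kq ?e1 ?e2.
(* Only p lies in the support: the first CNOT spreads Z from p to both qubits, the second removes it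
   from p. *)
pose s := to_Z v p ++ [:: GC q p; GC p q].
have sE : act s v = gact (GC p q) (gact (GC q p) w1) by rewrite /s !act_cat.
have cE : cnots s = [:: (q, p); (p, q)] by rewrite !cnots_cat !cnots_to_Z.
have [w1q1 w1q2] := w1o q qp'.
move: vq; rewrite /supp negb_or => /andP[/negPf vq1 /negPf vq2].
exists s; split.
- by rewrite !all_cat !lnn_to_Z /= /adjacent qp eqxx orbT.
- by rewrite !all_cat (gen_le_trans pleq (le_to_Z _ _)) /= pleq leqnn.
- move=> t k; rewrite cE /= /tick /= !eqxx (negPf pq) (negPf qp') /=.
  rewrite maxnn (maxnC (t q)) [(k == q) || _]orbC.
  by case: (_ || _) => //; rewrite addn2.
- rewrite sE /= !ffunE !eqxx ?(negPf pq) ?(negPf qp').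
  by rewrite w1p1 w1p2 w1q1 w1q2 vq1 vq2.
- move=> k /negPf kp /negPf kq; rewrite sE.
  have [e3 e4] := w1o k (negbT kp).
  by split; rewrite /= !ffunE ?kp ?kq.
Qed.

(** The invariant after j boxes. Box (j, j + 1) starts by D + 2j + 2 and ends by D + 2j + 4, so a
    sweep shifts the time profile D + 2k by four; the next sweep can follow in its wake. *)
Lemma partial_sweep v m t D : (exists2 k : 'I_n, (k <= m)%N & supp v k) ->
  (forall k, (k <= m)%N -> t k <= D + 2 * k)%N ->
  forall j : nat, (j <= m)%N -> exists s,
  [/\ all lnn s, all (gen_le m) s,
    [/\ forall k, (k < j)%N -> (finish (cnots s) t k <= D + 4 + 2 * k)%N,
        forall k, k = j :> nat ->
          (finish (cnots s) t k <= D + 2 * k + (0 < j).*2)%N &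
        forall k, (j < k)%N -> (finish (cnots s) t k <= t k)%N],
    forall k, (k < j)%N -> supp (act s v) k = false &
    exists2 k : 'I_n, (j <= k <= m)%N & supp (act s v) k].
Proof.
move=> [k0 k0m vk0] tD; elim=> [|j IH] jm.
  exists [::]; split=> //; last by exists k0.
  split=> // k k0'; apply: leq_trans (tD k _) (leq_addr _ _).
  by rewrite k0'.
have [s [ls sm [t1 t2 t3] s0 [k1 k1j vk1]]] := IH (ltnW jm).
have jn : (j.+1 < n)%N by exact: leq_ltn_trans jm (ltn_ord m).
pose p := Ordinal (ltnW jn); pose q := Ordinal jn.
have [s' [ls' sm' t' [p0 q0] o]] := @box_sweep (act s v) p q erefl.
exists (s ++ s'); split.
- by rewrite all_cat ls ls'.
- by rewrite all_cat sm (gen_le_trans _ sm').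
- have b (k : 'I_n) := t' (finish (cnots s) t) k.
  have tp : (finish (cnots s) t p <= D + 2 * j + 2)%N.
    apply: leq_trans (t2 p erefl) _; rewrite /= leq_add2l.
    by case: (0 < j)%N.
  have tq : (finish (cnots s) t q <= D + 2 * j.+1)%N.
    by apply: leq_trans (t3 q _) (tD q _) => /=.
  split=> k; rewrite cnots_cat finish_cat => kj; have := b k;
    rewrite -!val_eqE /=.
  + have := t1 k; clear -kj tp tq.
    case: (eqVneq (k : nat) j) => [->|ne] /= t1k; first by lia.
    case: eqP => [|_]; first by clear -kj; lia.
    by move/leq_trans; apply; apply: t1k; clear -kj ne; lia.
  + by rewrite kj eqxx orbT /=; clear -tp tq; lia.
  + have kj' : ((k : nat) == j) = false by clear -kj; lia.
    have kj'' : ((k : nat) == j.+1) = false by clear -kj; lia.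
    rewrite kj' kj'' /= => /leq_trans; apply; apply: t3.
    by clear -kj; lia.
- move=> k kj; rewrite act_cat; case: (eqVneq k p) => [->//|kp].
  have kj' : (k < j)%N.
    by move: kp; rewrite -val_eqE /=; clear -kj; lia.
  rewrite (same_at_supp (o k kp _)) ?s0 //.
  by rewrite -val_eqE /=; clear -kj; lia.
- rewrite act_cat; case: (boolP (supp (act s v) p || supp (act s v) q)) => pq.
    by exists q; rewrite ?q0 //= leqnn.
  move: pq; rewrite negb_or => /andP[np nq].
  have k1p : k1 != p by apply: contraNneq np => <-.
  have k1q : k1 != q by apply: contraNneq nq => <-.
  exists k1; last by rewrite (same_at_supp (o k1 k1p k1q)).
  by move: k1p; rewrite -val_eqE /=; clear -k1j; lia.
Qed.

Lemma sweep v m t D : (exists2 k : 'I_n, (k <= m)%N & supp v k) ->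
  (forall k, (k <= m)%N -> t k <= D + 2 * k)%N -> exists s,
  [/\ all lnn s, all (gen_le m) s,
    [/\ forall k, (k < m)%N -> (finish (cnots s) t k <= D + 4 + 2 * k)%N,
        (finish (cnots s) t m <= D + 4 * m)%N &
        forall k, (m < k)%N -> (finish (cnots s) t k <= t k)%N],
    forall k, (k < m)%N -> supp (act s v) k = false &
    (act s v).1 m = false /\ (act s v).2 m = true].
Proof.
move=> vs tD; have [s [ls sm [t1 t2 t3] s0 [k km vk]]] :=
  partial_sweep vs tD (leqnn m).
have vm : supp (act s v) m.
  by rewrite -(_ : k = m) //; apply: val_inj => /=; clear -km; lia.
exists (s ++ to_Z (act s v) m).
have cE : cnots (s ++ to_Z (act s v) m) = cnots s.
  by rewrite cnots_cat cnots_to_Z cats0.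
split.
- by rewrite all_cat ls lnn_to_Z.
- by rewrite all_cat sm le_to_Z.
- rewrite cE; split=> //.
  (* For m > 0 use 2m + 2 <= 4m; for m = 0 no box is applied. *)
  by have := t2 m erefl; case: (nat_of_ord m) => [|j] /=; lia.
- move=> i im; rewrite act_cat.
  have ine : i != m by rewrite -val_eqE /=; clear -im; lia.
  by rewrite (same_at_supp (act_to_Z_other _ _ ine)) s0.
- by rewrite act_cat; apply: act_to_Z.
Qed.

(** The shape of row i in a matrix with ones on the antidiagonal and zeros to its left. *)
Definition anti_tri (i : nat) (b : bits n) :=
  (forall k, (i + k < n.-1)%N -> b k = false) /\
  (forall k, (i + k)%N = n.-1 -> b k = true).

(** Back substitution from the last coordinate: row d has its first one at k = n - 1 - d, and the
    coordinates of [a] after k are already known to vanish. *)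
Lemma anti_tri_orth (b : 'I_n -> bits n) (a : bits n) j :
  (forall i, (i < j)%N -> anti_tri i (b i)) ->
  (forall i, (i < j)%N -> dot (b i) a = false) ->
  forall k, (n <= k + j)%N -> a k = false.
Proof.
move=> tri orth k kj.
have [d kd] : exists d, (d + k)%N = n.-1.
  by exists (n.-1 - k)%N; have := ltn_ord k; lia.
elim/ltn_ind: d k kj kd => d IH k kj kd.
have dn : (d < n)%N by have := ltn_ord k; lia.
pose i := Ordinal dn; have ij : (i < j)%N by rewrite /=; lia.
have [z o] := tri i ij; have := orth i ij.
rewrite (dotD1 k) (o k kd) /= /rest_dot big1 ?addbF // => k' k'k.
case: (ltngtP (k' : nat) k) => kk.
- by rewrite z /=; [rewrite mul0r | lia].
- have kn := ltn_ord k'.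
  by rewrite (IH (n.-1 - k')%N) ?mulr0 //; lia.
- by rewrite (val_inj kk) eqxx in k'k.
Qed.

(** The dual family [u] ensures that the image of [v j] still has support on the first n - j qubits.
    Sweep j runs over these with D = 4j; its last qubit m = n - 1 - j gives D + 4m = 4n - 4. *)
Lemma stage1 (v u : 'I_n -> pauli n) :
  (forall i j, sympl (v i) (v j) = false) ->
  (forall i, sympl (v i) (u i) = true) ->
  (forall i j, i != j -> sympl (v i) (u j) = false) ->
  exists s, [/\ all lnn s,
    forall q, (finish (cnots s) (fun=> 0) q <= 4 * n - 4)%N &
    exists b : 'I_n -> bits n,
      forall i, act s (v i) = (0, b i) /\ anti_tri i (b i)].
Proof.
move=> vv vu vu'.
have H (j : nat) : (j <= n)%N -> exists s, [/\ all lnn s,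
    forall q, (q + j < n)%N -> (finish (cnots s) (fun=> 0) q <= 4 * j + 2 * q)%N,
    forall q, (n <= q + j)%N -> (finish (cnots s) (fun=> 0) q <= 4 * n - 4)%N &
    forall i, (i < j)%N ->
      (act s (v i)).1 = 0 /\ anti_tri i (act s (v i)).2].
  elim: j => [_|j IH jn].
    by exists [::].
  have [s [ls t1 t2 tri]] := IH (ltnW jn).
  have ws := lnn_all_wf ls.
  pose J := Ordinal jn.
  have mn : (n - j.+1 < n)%N by lia.
  pose m := Ordinal mn.
  pose x := act s (v J); pose y := act s (u J).
  have orth w i : (i < j)%N -> sympl (v i) w = false ->
      dot (act s (v i)).2 (act s w).1 = false.
    move=> ij; rewrite -(act_sympl _ _ ws) /sympl (tri i ij).1.
    by rewrite dot0l.
  (* Since x and y commute with the earlier operators, which are Z-type and anti-triangular, neither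
     has an X part on the last j qubits. *)
  have x0 : forall k, (n <= k + j)%N -> x.1 k = false.
    apply: (@anti_tri_orth (fun i => (act s (v i)).2)).
      by move=> i /tri[].
    by move=> i ij; apply: orth.
  have y0 : forall k, (n <= k + j)%N -> y.1 k = false.
    apply: (@anti_tri_orth (fun i => (act s (v i)).2)).
      by move=> i /tri[].
    move=> i ij; apply: orth => //; apply: vu'.
    by rewrite -val_eqE /=; clear -ij; lia.
  (* Otherwise x is trivial up to m, while beyond m both x and y are Z-type, so they would
     commute. *)
  have xs : exists2 k : 'I_n, (k <= m)%N & supp x k.
    have [/existsP[k /andP[km vk]]|/existsPn nx] :=
      boolP [exists k : 'I_n, (k <= m)%N && supp x k]; first by exists k.
    have nx' k : (k <= m)%N -> x.1 k = false /\ x.2 k = false.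
      move=> km; have := nx k; rewrite km /= /supp negb_or.
      by case/andP=> /negPf -> /negPf ->.
    have := vu J; rewrite -(act_sympl _ _ ws) -/x -/y /sympl.
    rewrite /dot !big1 // => k _.
      case: (leqP k m) => km; first by rewrite (nx' k km).2 mul0r.
      by rewrite y0 ?mulr0 //=; move: km => /=; clear -jn; lia.
    case: (leqP k m) => km; first by rewrite (nx' k km).1 mul0r.
    by rewrite x0 ?mul0r //=; move: km => /=; clear -jn; lia.
  have tm k : (k <= m)%N -> (finish (cnots s) (fun=> 0) k <= 4 * j + 2 * k)%N.
    by move=> /= km; apply: t1; clear -km jn; lia.
  have [s' [ls' sm [t1' t2' t3'] z [z1 z2]]] := sweep xs tm.
  exists (s ++ s'); rewrite all_cat ls ls' cnots_cat; split=> //.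
  - move=> q qj; rewrite finish_cat; apply: leq_trans (t1' q _) _ => /=;
      clear -qj jn; lia.
  - move=> q qj; rewrite finish_cat; case: (ltngtP q m) => qm.
    + by move: qm => /=; clear -jn qj; lia.
    + by apply: leq_trans (t3' q qm) (t2 q _); move: qm => /=; clear -jn qj; lia.
    + by rewrite (val_inj qm : q = m); apply: leq_trans t2' _ => /=;
        clear -jn; lia.
  move=> i; rewrite ltnS leq_eqVlt => /orP[/eqP ij|ij]; rewrite act_cat.
    rewrite (_ : i = J) -/x; last exact: val_inj.
    have b1 k : (act s' x).1 k = false.
      case: (ltngtP k m) => km.
      + by move/negbT: (z k km); rewrite negb_or => /andP[/negPf].
      + rewrite (act_above _ sm km).1 x0 //; move: km => /=; clear -jn; lia.
      + by rewrite (val_inj km : k = m).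
    split; first by apply/ffunP => k; rewrite b1 bits0.
    split=> k kn.
      have km : (k < m)%N by move: kn => /=; clear -jn; lia.
      by move/negbT: (z k km); rewrite negb_or => /andP[_ /negPf].
    by rewrite (_ : k = m) //; apply: val_inj; move: kn => /=; clear -jn; lia.
  (* The earlier operators are supported strictly to the right of m. *)
  rewrite (act_trivial sm) ?(tri i ij) //; first by case: (tri i ij).
  move=> k km; have [e [e0 _]] := tri i ij; rewrite /supp e bits0 e0 //=.
  by move: km => /=; clear -ij jn; lia.
have [s [ls _ t tri]] := H n (leqnn n).
exists s; split=> //; first by move=> q; apply: t; rewrite leq_addl.
exists (fun i => (act s (v i)).2) => i; have [e T] := tri i (ltn_ord i).
by split=> //; rewrite -e; case: (act s (v i)).
Qed.

End Sweeps.

(** * Phases obtained by inserting P gates *)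

Section Phases.

Local Open Scope ring_scope.

Variables (C : numClosedFieldType) (n : nat).
Implicit Types (ps : seq ('I_n * 'I_n)) (x y z : bits n) (q : 'I_n).
Implicit Types (m : 'I_n -> nat) (phi psi : bits n -> C).

Definition run ps x : bits n := foldl (fun x' p => cnotf p.1 p.2 x') x ps.

Lemma run_cat ps1 ps2 x : run (ps1 ++ ps2) x = run ps2 (run ps1 x).
Proof. by rewrite /run foldl_cat. Qed.

Definition lin m x : nat := (\sum_q m q * x q)%N.

(* The diagonal phases obtained by inserting P gates anywhere between the CNOT
   gates ps, as functions of the input of the circuit. *)
Fixpoint insertable ps phi : Prop :=
  match ps with
  | [::] => exists m, forall x, phi x = 'i ^+ lin m x
  | p :: ps' => exists m psi, insertable ps' psi /\
      forall x, phi x = 'i ^+ lin m x * psi (cnotf p.1 p.2 x)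
  end.

Lemma eq_insertable ps phi psi :
  phi =1 psi -> insertable ps phi -> insertable ps psi.
Proof.
case: ps => [|p ps] e /= [m]; first by move=> H; exists m => x; rewrite -e.
by case=> psi' [H H']; exists m, psi'; split=> // x; rewrite -e.
Qed.

Lemma lin_add m m' x : lin (fun q => m q + m' q)%N x = (lin m x + lin m' x)%N.
Proof. by rewrite /lin -big_split; apply: eq_bigr => q _; rewrite mulnDl. Qed.

Lemma insertableM ps phi psi : insertable ps phi -> insertable ps psi ->
  insertable ps (fun x => phi x * psi x).
Proof.
elim: ps phi psi => [|p ps IH] phi psi /= [m H] [m' H'].
  by exists (fun q => m q + m' q)%N => x; rewrite H H' lin_add exprD.
case: H H' => f [rf ef] [g [rg eg]].
exists (fun q => m q + m' q)%N, (fun x => f x * g x); split; first exact: IH.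
by move=> x; rewrite ef eg lin_add exprD mulrACA.
Qed.

Lemma insertable_lin ps m : insertable ps (fun x => 'i ^+ lin m x).
Proof.
have lin0 x : 'i ^+ lin (fun=> 0%N) x = 1 :> C.
  by rewrite /lin big1 ?expr0.
elim: ps m => [|p ps IH] m /=; first by exists m.
exists m, (fun=> 1); split; last by move=> x; rewrite mulr1.
by apply: eq_insertable (IH (fun=> 0%N)) => x; rewrite lin0.
Qed.

Lemma insertable_wire ps c q : insertable ps (fun x => 'i ^+ (c * x q)).
Proof.
apply: eq_insertable (insertable_lin ps (fun q' => if q' == q then c else 0%N)).
move=> x; rewrite /lin (bigD1 q) //= eqxx big1 ?addn0 // => q' /negPf ->.
by rewrite mul0n.
Qed.

Lemma insertable1 ps : insertable ps (fun=> 1).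
Proof.
apply: eq_insertable (insertable_lin ps (fun=> 0%N)) => x.
by rewrite /lin big1 ?expr0.
Qed.

Lemma insertable_prod (I : Type) (r : seq I) (P : pred I) ps
    (F : I -> bits n -> C) : (forall i, P i -> insertable ps (F i)) ->
  insertable ps (fun x => \prod_(i <- r | P i) F i x).
Proof.
move=> H; elim: r => [|i r IH].
  by apply: eq_insertable (insertable1 ps) => x; rewrite big_nil.
case: (boolP (P i)) => Pi.
  apply: eq_insertable (insertableM (H i Pi) IH) => x.
  by rewrite big_cons Pi.
by apply: eq_insertable IH => x; rewrite big_cons (negPf Pi).
Qed.

Lemma insertable_catr ps1 ps2 psi : insertable ps2 psi ->
  insertable (ps1 ++ ps2) (fun x => psi (run ps1 x)).
Proof.
move=> H; elim: ps1 => [|p ps1 IH] //=.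
exists (fun=> 0%N), (fun x => psi (run ps1 x)); split=> // x.
by rewrite /lin big1 ?expr0 ?mul1r.
Qed.

Lemma insertable_catl ps1 ps2 phi :
  insertable ps1 phi -> insertable (ps1 ++ ps2) phi.
Proof.
elim: ps1 phi => [|p ps1 IH] phi /=.
  case=> m e; apply: eq_insertable (insertable_lin ps2 m) => x; by rewrite e.
by case=> m [psi [/IH H e]]; exists m, psi.
Qed.

Definition phase_word m : seq (gen n) :=
  flatten [seq nseq (m q) (GP q) | q <- enum 'I_n].

Lemma entry_phase_word m x y :
  entry (eval C (phase_word m)) x y = 'i ^+ lin m y *+ (x == y).
Proof.
rewrite /phase_word /lin -big_enum /= ; elim: (enum 'I_n) => [|q r IH] /=.
  by rewrite entry1 big_nil expr0.
rewrite eval_cat (entry_mul_mono (f := id) _ _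
  (p := fun y => 'i ^+ (m q * y q))).
  by rewrite IH big_cons addnC exprD mulrnAl.
move=> z; elim: (m q) z => [|k IHk] z; first by rewrite entry1 mul0n expr0.
rewrite [eval _ _]/= (entry_mul_mono (f := id) _ _
  (p := fun y => 'i ^+ y q)); last by move=> z'; exact: entry_P.
by rewrite IHk mulSn exprD mulrC mulrnAr.
Qed.

Lemma phase_word_cnots m : cnots (phase_word m) = [::].
Proof.
rewrite /phase_word; elim: (enum 'I_n) => [|q r IH] //=.
by rewrite cnots_cat IH cats0; elim: (m q).
Qed.

Lemma phase_word_lnn m : all lnn (phase_word m).
Proof.
rewrite /phase_word; elim: (enum 'I_n) => [|q r IH] //=.
by rewrite all_cat IH andbT; elim: (m q).
Qed.

(** The inserted P gates leave the list of CNOT gates, hence the depth, unchanged. *)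
Lemma insertable_word ps phi : insertable ps phi ->
  all (fun p => adjacent p.1 p.2) ps -> exists s,
  [/\ all lnn s, cnots s = ps &
      forall x y, entry (eval C s) x y = phi y *+ (x == run ps y)].
Proof.
elim: ps phi => [|[c t] ps IH] phi /=.
  case=> m e _; exists (phase_word m).
  rewrite phase_word_lnn phase_word_cnots; split=> // x y.
  by rewrite entry_phase_word e.
case=> m [psi [/IH{}IH e]] /andP[ct /IH[s [ls cs es]]].
exists (phase_word m ++ GC c t :: s); split.
- by rewrite all_cat phase_word_lnn /= ct.
- by rewrite cnots_cat phase_word_cnots /= cs.
move=> x y; rewrite eval_cat [eval C (_ :: _)]/= -mulmxA.
rewrite (entry_mul_mono (f := cnotf c t) _ _ (p := fun y => 'i ^+ lin m y)).
  by rewrite es e mulrC mulrnAr.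
move=> z; rewrite (entry_mul_mono (f := id) _ _ (p := fun y => 'i ^+ lin m y)).
  by rewrite entry_C mulr_natl.
by move=> z'; exact: entry_phase_word.
Qed.

(** For bits x and y, i^(x + y) times i^(3 (x xor y)) equals (-1)^(xy). So P^3 on a wire carrying
    the sum, with P on the two wires, yields the sign. *)
Lemma insertable_sign ps q q' : insertable ps (fun x => 'i ^+ (x q + x q')) ->
  insertable ps (fun x => 'i ^+ (3 * (x q (+) x q'))) ->
  insertable ps (fun x => (-1) ^+ (x q && x q')).
Proof.
move=> H H'; apply: eq_insertable (insertableM H H') => x.
have i2 : 'i ^+ 2 = -1 :> C by exact: sqrCi.
have i4 : 'i ^+ 4 = 1 :> C by rewrite (exprM 'i 2 2) i2 sqrrN expr1n.
rewrite -exprD; case: (x q); case: (x q').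
- exact: i2.
- exact: i4.
- exact: i4.
- exact: expr0.
Qed.

Lemma sign_sum (I : finType) (F : I -> bool) :
  (-1) ^+ ((\sum_i F i)%R : bool) = \prod_i (-1) ^+ F i :> C.
Proof.
apply: (big_morph (fun b : bool => (-1) ^+ b : C)) => //.
by move=> a b; rewrite -signr_addb.
Qed.

Lemma sign_dotM (a b z : bits n) : (-1) ^+ (dot a z && dot b z) =
  \prod_(u : 'I_n * 'I_n) (-1) ^+ [&& a u.1, b u.2, z u.1 & z u.2] :> C.
Proof.
rewrite -sign_sum; congr (_ ^+ nat_of_bool _).
rewrite -[LHS]/(dot a z * dot b z) /dot big_distrlr /= pair_big /=.
apply: eq_bigr => -[i j] _ /=.
by case: (a i); case: (b j); case: (z i); case: (z j).
Qed.

(** Descending induction on p + q: expanding the product of the two functionals gives the term (p,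
    q) and terms (i, j) with i >= p, j >= q and a larger sum. *)
Lemma insertable_quadratic ps :
  (forall p q : 'I_n, (p < q)%N -> exists a b : bits n,
    [/\ a p /\ (forall k, a k -> (p <= k)%N),
        b q /\ (forall k, b k -> (q <= k)%N) &
        insertable ps (fun x => (-1) ^+ (dot a x && dot b x))]) ->
  forall p q, insertable ps (fun x => (-1) ^+ (x p && x q)).
Proof.
move=> H.
have square p : insertable ps (fun x => (-1) ^+ x p).
  apply: eq_insertable (insertable_wire ps 2 p) => x.
  by rewrite exprM sqrCi.
have lt_case (d : nat) : forall p q : 'I_n, (2 * n <= p + q + d)%N ->
    insertable ps (fun x => (-1) ^+ (x p && x q)).
  elim: d => [|d IH].
    by move=> p q; have := ltn_ord p; have := ltn_ord q; lia.
  suff IH' : forall p q : 'I_n, (p < q)%N -> (2 * n <= p + q + d.+1)%N ->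
      insertable ps (fun x => (-1) ^+ (x p && x q)).
    move=> p q pqd; case: (ltngtP (p : nat) q) => pq; first exact: IH'.
      apply: eq_insertable (IH' q p pq _) => [x|]; first by rewrite andbC.
      by rewrite [(q + p)%N]addnC.
    by rewrite (val_inj pq); apply: eq_insertable (square q) => x; rewrite andbb.
  move=> p q pq pqd; have [a [b [[ap al] [bq bl] rab]]] := H p q pq.
  (* Signs are their own inverses, so multiplying by the other terms of the expansion cancels
     them. *)
  apply: (eq_insertable (phi := fun x => (-1) ^+ (dot a x && dot b x) *
     \prod_(u | u != (p, q)) (-1) ^+ [&& a u.1, b u.2, x u.1 & x u.2])).
    move=> x; rewrite sign_dotM (bigD1 (p, q)) //= ap bq /= -mulrA.
    rewrite -[X in _ * X]big_split /= big1 ?mulr1 // => u _.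
    by rewrite -signr_addb addbb.
  apply: insertableM => //; apply: insertable_prod => -[i j] ij /=.
  case: (boolP (a i)) => ai; last exact: insertable1.
  case: (boolP (b j)) => bj; last exact: insertable1.
  apply: IH; have := al i ai; have := bl j bj; move: ij.
  by rewrite xpair_eqE -!val_eqE /=; clear -pqd; lia.
by move=> p q; apply: (lt_case (2 * n)%N); rewrite leq_addl.
Qed.

End Phases.

(** * Odd-even transposition *)

Section WireLabels.

Local Open Scope nat_scope.

(* Odd-even transposition: at time t the wires in positions k and k + 1 with k = t
   mod 2 are exchanged, and [lab n t p] is the initial position of the wire that
   occupies position p at time t <= n.  A wire moves at unit speed and is
   reflected at the two ends of the line. *)
Definition lab (n t p : nat) : nat :=
  if odd p == odd t then (if t <= p then p - t else (t - p).-1)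
  else (if p + t < n then p + t else (2 * n - (p + t)).-1).

Definition swapped (n t k : nat) := (odd k == odd t) && (k.+1 < n).

Definition mv (n t p : nat) : nat :=
  if swapped n t p then p.+1
  else if (odd p != odd t) && (0 < p) then p.-1 else p.

Lemma lab0 n p : p < n -> lab n 0 p = p.
Proof. by rewrite /lab; case: ifP => _ pn; rewrite ?subn0 // addn0 pn. Qed.

Lemma lab_end n p : p < n -> lab n n p = n - p.+1.
Proof. by rewrite /lab; case: ifP => _; [case: ifP | case: ifP]; lia. Qed.

(** By the final inequality an exchange always moves the smaller label to the right, so two wires
    cross at most once. *)
Lemma lab_swap n t k : swapped n t k -> t < n ->
  [/\ lab n t.+1 k = lab n t k.+1, lab n t.+1 k.+1 = lab n t k
    & lab n t k < lab n t k.+1].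
Proof.
rewrite /swapped /lab !oddS => /andP[/eqP -> kn] tn.
by case: (odd t) => /=; split; repeat case: ifP; lia.
Qed.

Lemma lab_mv n t p : p < n -> t < n -> lab n t.+1 (mv n t p) = lab n t p.
Proof.
move=> pn tn; rewrite /mv; case: ifP => [sp|]; first by case: (lab_swap sp tn).
case: ifP => [/andP[op p0] _|].
  have sp : swapped n t p.-1.
    case: p p0 op pn => //= p _; rewrite /swapped.
    by case: (odd p); case: (odd t).
  by have [-> _ _] := lab_swap sp tn; rewrite prednK.
rewrite /swapped /lab oddS; case: (odd p); case: (odd t) => /=;
  repeat case: ifP; lia.
Qed.

(** Wires move by at most one step, and parity excludes any collision or crossing other than a
    direct exchange. *)
Lemma mv_lt n t p q : p < q -> q < n -> ~~ (swapped n t p && (q == p.+1)) ->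
  mv n t p < mv n t q.
Proof.
rewrite /mv /swapped => pq qn.
have oq : q = p.+1 -> odd q = ~~ odd p by move=> ->.
have oq2 : q = p.+2 -> odd q = odd p by move=> -> /=; rewrite negbK.
move: oq oq2; case: (odd p); case: (odd q); case: (odd t) => /= oq oq2;
  repeat case: ifP; lia.
Qed.

Lemma mv_ltn n t p : p < n -> mv n t p < n.
Proof. by rewrite /mv /swapped; repeat case: ifP; lia. Qed.

End WireLabels.

(** * Parallel boxes and their effect on linear functionals *)

Section Layers.

Local Open Scope ring_scope.

Variables (C : numClosedFieldType) (n : nat).
Implicit Types (ps : seq ('I_n * 'I_n)) (x y z b : bits n) (p q k : 'I_n).
Implicit Types (a : 'I_n -> bool) (ks : seq 'I_n) (t : nat).

Definition next k : 'I_n := insubd k k.+1.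

Lemma val_next k : (k.+1 < n)%N -> next k = k.+1 :> nat.
Proof. by move=> kn; rewrite /next val_insubd kn. Qed.

(** Three CNOT gates make a swap; without the last one, (x, y) becomes (y, x + y). *)
Definition box c k : seq ('I_n * 'I_n) :=
  (k, next k) :: (next k, k) :: (if c then [::] else [:: (k, next k)]).

Definition boxes a ks := flatten [seq box (a k) k | k <- ks].

Lemma boxes_cons a k ks : boxes a (k :: ks) = box (a k) k ++ boxes a ks.
Proof. by []. Qed.

(** The inverse transpose of [run ps]: it rewrites a functional of the inputs as a functional of the
    outputs. *)
Definition radj ps b : bits n :=
  foldl (fun b' (p : 'I_n * 'I_n) => cnotf p.2 p.1 b') b ps.

Definition distinct (p : 'I_n * 'I_n) := p.1 != p.2.

Lemma dot_radj ps b x :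
  all distinct ps -> dot (radj ps b) (run ps x) = dot b x.
Proof.
elim: ps b x => [|p ps IH] b x //= /andP[dp dps].
by rewrite IH // dot_cnotf.
Qed.

Lemma radj_surj ps b : all distinct ps -> exists b', radj ps b' = b.
Proof.
elim: ps b => [|p ps IH] b /=; first by exists b.
case/andP=> dp /(IH b)[b' e]; exists (cnotf p.2 p.1 b').
by rewrite /radj /= cnotfK // eq_sym.
Qed.

Lemma next_neq k : (k.+1 < n)%N -> k != next k.
Proof. by move=> kn; rewrite -val_eqE /= val_next //; lia. Qed.

Lemma radj_box c k b : (k.+1 < n)%N ->
  [/\ radj (box c k) b k = b (next k) (+) (c && b k),
      radj (box c k) b (next k) = b k
    & forall p, p != k -> p != next k -> radj (box c k) b p = b p].
Proof.
move=> kn; have /negPf d := next_neq kn.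
have d' : (next k == k) = false by rewrite eq_sym.
rewrite /radj /box; case: c; split=> [||p /negPf pk /negPf pq];
  rewrite /= !ffunE ?eqxx ?d ?d' ?pk ?pq ?ffunE ?eqxx ?d ?d' ?pk ?pq //.
- by rewrite addbC.
- by rewrite addbC addbK.
- by case: (b k); case: (b (next k)).
- by case: (b k); case: (b (next k)).
Qed.

Lemma box_disjoint t k k' : swapped n t k -> swapped n t k' -> k != k' ->
  [/\ k' != k, k' != next k, next k' != k & next k' != next k].
Proof.
rewrite /swapped => /andP[/eqP ek kn] /andP[/eqP ek' kn'] kk.
rewrite eq_sym kk -!val_eqE /= !val_next //.
have o1 : odd k.+1 = ~~ odd t by rewrite oddS ek.
have o2 : odd k'.+1 = ~~ odd t by rewrite oddS ek'.
split=> //; apply/eqP => e.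
- by move: ek'; rewrite e o1; case: odd.
- by move: o2; rewrite e ek; case: odd.
- by case: e => /val_inj e; rewrite e eqxx in kk.
Qed.

Lemma radj_boxes t a ks b : uniq ks -> all (fun k : 'I_n => swapped n t k) ks ->
  (forall k, k \in ks ->
     radj (boxes a ks) b k = b (next k) (+) (a k && b k) /\
     radj (boxes a ks) b (next k) = b k) /\
  (forall p, p \notin ks -> (forall k, k \in ks -> p != next k) ->
     radj (boxes a ks) b p = b p).
Proof.
elim: ks b => [|k0 ks IH] b //= /andP[k0ks uks] /andP[s0 sks].
have [IH1 IH2] := IH (radj (box (a k0) k0) b) uks sks.
have kn : (k0.+1 < n)%N by case/andP: s0.
have [r1 r2 r3] := radj_box (a k0) b kn.
have rE p : radj (boxes a (k0 :: ks)) b p =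
    radj (boxes a ks) (radj (box (a k0) k0) b) p.
  by rewrite /radj -foldl_cat.
have dis k : k \in ks ->
    [/\ k != k0, k != next k0, next k != k0 & next k != next k0].
  move=> kks; apply: box_disjoint s0 (allP sks k kks) _.
  by apply: contraNneq k0ks => ->.
split.
  move=> k; rewrite inE => /orP[/eqP ->|kks]; rewrite !rE.
    rewrite !IH2 ?r1 ?r2 //.
    - by apply/negP => /dis[_ /eqP].
    - by move=> k1 /dis[_ _ _]; rewrite eq_sym.
    - by move=> k1 /dis[_ _]; rewrite eq_sym.
  have [d1 d2 d3 d4] := dis k kks; have [-> ->] := IH1 k kks.
  by rewrite !r3.
move=> p; rewrite inE negb_or => /andP[pk0 pks] pn; rewrite rE IH2 //.
  by rewrite r3 // pn // mem_head.
by move=> k kks; apply: pn; rewrite inE kks orbT.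
Qed.

Lemma finish_box c k (tt : 'I_n -> nat) p : (k.+1 < n)%N ->
  (finish (box c k) tt p <=
    if (p == k) || (p == next k) then maxn (tt k) (tt (next k)) + 3 else tt p)%N.
Proof.
move=> kn; have /negPf d := next_neq kn.
have d' : (next k == k) = false by rewrite eq_sym.
rewrite /box /finish; case: c; rewrite /= /tick /= !eqxx ?d ?d' /= ?orbT ?maxnn;
  rewrite ?[(p == next k) || _]orbC; case: (_ || _) => //.
all: by rewrite addn3 ?maxnn; rewrite ltnS // leqnSn.
Qed.

(** The boxes are disjoint and run in parallel: wires of pending boxes are free at T, while wires of
    finished boxes may be busy until T + 3. *)
Lemma finish_boxes t a ks (tt : 'I_n -> nat) T :
  uniq ks -> all (fun k : 'I_n => swapped n t k) ks ->
  (forall k, k \in ks -> tt k <= T /\ tt (next k) <= T)%N ->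
  (forall p, tt p <= T + 3)%N ->
  forall p, (finish (boxes a ks) tt p <= T + 3)%N.
Proof.
elim: ks tt => [|k0 ks IH] tt //.
rewrite [uniq _]/= [all _ _]/= => /andP[k0ks uks] /andP[s0 sks] tks tp p.
have kn : (k0.+1 < n)%N by case/andP: s0.
rewrite boxes_cons finish_cat.
apply: IH => // [k kks|p'].
  have k0k : k0 != k by apply: contraNneq k0ks => ->.
  have [d1 d2 d3 d4] := box_disjoint s0 (allP sks k kks) k0k.
  have [tk1 tk2] := tks k (mem_behead (s := k0 :: ks) kks).
  split; apply: leq_trans (finish_box _ _ _ kn) _.
    by rewrite (negPf d1) (negPf d2).
  by rewrite (negPf d3) (negPf d4).
apply: leq_trans (finish_box _ _ _ kn) _; case: ifP => // _.
by rewrite leq_add2r geq_max; case: (tks k0 (mem_head _ _)) => -> ->.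
Qed.

Lemma run_box_other c k x p : p != k -> p != next k -> run (box c k) x p = x p.
Proof.
move=> /negPf pk /negPf pq; rewrite /run /box.
by case: c; rewrite /= !ffunE ?pk ?pq ?ffunE ?pk ?pq ?ffunE ?pk ?pq.
Qed.

Lemma insertable_boxes t a ks k :
  uniq ks -> all (fun k : 'I_n => swapped n t k) ks -> k \in ks ->
  insertable (boxes a ks) (fun x => (-1) ^+ (x k && x (next k)) : C).
Proof.
elim: ks => [|k0 ks IH] //.
rewrite [uniq _]/= [all _ _]/= => /andP[k0ks uks] /andP[s0 sks].
have kn : (k0.+1 < n)%N by case/andP: s0.
rewrite boxes_cons.
rewrite inE => /orP[/eqP ->|kks]; last first.
  have k0k : k0 != k by apply: contraNneq k0ks => ->.
  have [d1 d2 d3 d4] := box_disjoint s0 (allP sks k kks) k0k.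
  apply: eq_insertable (insertable_catr (box (a k0) k0) (IH uks sks kks)) => x.
  by rewrite !run_box_other.
apply: insertable_sign.
  apply: eq_insertable (insertableM (insertable_wire _ _ 1 k0)
    (insertable_wire _ _ 1 (next k0))) => x.
  by rewrite !mul1n exprD.
(* After the first CNOT of the box, [next k0] carries the sum, and P^3 is inserted there. *)
rewrite /box -cat1s -catA.
apply: eq_insertable (insertable_catr _ (insertable_wire _ _ 3 (next k0))) => x.
by rewrite /run /= ffunE eqxx addbC.
Qed.

Lemma boxes_adjacent t a ks : all (fun k : 'I_n => swapped n t k) ks ->
  all (fun p : 'I_n * 'I_n => adjacent p.1 p.2) (boxes a ks).
Proof.
elim: ks => [|k ks IH] // /andP[/andP[_ kn] sks].
rewrite boxes_cons all_cat IH // andbT /=.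
rewrite /adjacent val_next // !eqxx orbT.
by case: (a k); rewrite /= ?val_next ?eqxx.
Qed.

Lemma adjacent_distinct ps :
  all (fun p : 'I_n * 'I_n => adjacent p.1 p.2) ps -> all distinct ps.
Proof.
apply: sub_all => -[c t] ct.
exact: (@lnn_wf n (GC c t)).
Qed.

End Layers.

(** * The complete odd-even circuit *)

Section Brick.

Local Open Scope ring_scope.

Variables (C : numClosedFieldType) (n : nat).
Implicit Types (ps : seq ('I_n * 'I_n)) (x y z b c : bits n) (p q k : 'I_n).
Implicit Types (a : 'I_n -> bool) (t : nat) (R : nat -> bits n).

Definition layer_pos t : seq 'I_n := [seq k : 'I_n <- enum 'I_n | swapped n t k].

Definition layer a t := boxes a (layer_pos t).

Lemma layer_uniq t : uniq (layer_pos t).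
Proof. by rewrite filter_uniq // enum_uniq. Qed.

Lemma layer_all t :
  all (fun k : 'I_n => swapped n t k) (layer_pos t).
Proof. exact: filter_all. Qed.

Lemma mem_layer t k :
  (k \in layer_pos t) = swapped n t k.
Proof. by rewrite mem_filter mem_enum andbT. Qed.

Lemma layer_adjacent a t :
  all (fun p : 'I_n * 'I_n => adjacent p.1 p.2) (layer a t).
Proof. exact/boxes_adjacent/layer_all. Qed.

Lemma finish_layer a t (tt : 'I_n -> nat) T : (forall p, tt p <= T)%N ->
  forall p, (finish (layer a t) tt p <= T + 3)%N.
Proof.
move=> tT; apply: finish_boxes (layer_uniq t) (layer_all t) _ _ => // p.
by apply: leq_trans (tT p) (leq_addr _ _).
Qed.

Lemma radj_layer a t b :
  (forall k, swapped n t k ->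
     radj (layer a t) b k = b (next k) (+) (a k && b k) /\
     radj (layer a t) b (next k) = b k) /\
  (forall p, ~~ swapped n t p -> (forall k, swapped n t k -> p != next k) ->
     radj (layer a t) b p = b p).
Proof.
have [H1 H2] := radj_boxes a b (layer_uniq t) (layer_all t).
split=> [k sk|p sp pn]; first by apply: H1; rewrite mem_layer.
by apply: H2 => [|k]; rewrite mem_layer //; exact: pn.
Qed.

Definition mvo t p : 'I_n := Ordinal (mv_ltn t (ltn_ord p)).

Variant pos_spec t p : Prop :=
  | PosLeft of swapped n t p & mvo t p = next p
  | PosRight k of swapped n t k & p = next k & mvo t p = k
  | PosFixed of ~~ swapped n t p & (forall k, swapped n t k -> p != next k) &
      mvo t p = p.

Lemma posP t p : pos_spec t p.
Proof.
case: (boolP (swapped n t p)) => sp.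
  apply: PosLeft => //; apply: val_inj; rewrite /= /mv sp val_next //.
  by case/andP: sp.
case: (boolP ((odd p != odd t) && (0 < p)%N)) => c.
  have pn := ltn_ord p; have kn : (p.-1 < n)%N by lia.
  case/andP: (c) => op p0.
  have pk : p = p.-1.+1 :> nat by rewrite prednK.
  have sk : swapped n t p.-1.
    have -> : swapped n t p.-1 = (odd p.-1 == odd t).
      by rewrite /swapped -pk pn andbT.
    have e : odd p = ~~ odd p.-1 by rewrite -oddS -pk.
    by move: op; rewrite e; case: (odd p.-1); case: (odd t).
  apply: (@PosRight _ _ (Ordinal kn)) => //; apply: val_inj => /=.
    by rewrite val_next -?pk //=; rewrite -pk.
  by rewrite /mv (negPf sp) c.
apply: PosFixed => // [k /andP[/eqP ek kn]|]; last first.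
  by apply: val_inj; rewrite /= /mv (negPf sp) (negPf c).
apply/eqP => pk; move: c; rewrite pk val_next // oddS ek andbT.
by case: odd.
Qed.

Lemma lab_mvo t p : (t < n)%N -> lab n t.+1 (mvo t p) = lab n t p.
Proof. by move=> tn; rewrite lab_mv. Qed.

Lemma lab_next t k : (t < n)%N -> swapped n t k ->
  [/\ lab n t.+1 k = lab n t (next k), lab n t.+1 (next k) = lab n t k
    & (lab n t k < lab n t (next k))%N].
Proof.
move=> tn sk; rewrite val_next; first exact: lab_swap.
by case/andP: sk.
Qed.

(* Row l of R expresses the wanted final value of wire l in terms of the values at
   time t: besides wire l itself, only wires that l still has to meet occur. *)
Definition unmet_rows t R := forall (l : nat) p,
  (lab n t p = l -> R l p) /\
  (R l p -> lab n t p = l \/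
    (l < lab n t p)%N /\ exists2 p' : 'I_n, (p' < p)%N & lab n t p' = l).

(** The wire at p has the least label in the support of c. At time 0 labels are positions, which
    gives the triangular shape required by [insertable_quadratic]. *)
Definition leading t p c :=
  c p /\ forall p', c p' -> (lab n t p <= lab n t p')%N.

(** The last CNOT of the box at k is dropped exactly when the row of its left wire has coefficient
    one at [next k]; this clears that coefficient at the moment the two wires cross. *)
Lemma unmet_rows_step t R : (t < n)%N -> unmet_rows t R ->
  unmet_rows t.+1
    (fun l => radj (layer (fun k => R (lab n t k) (next k)) t) (R l)).
Proof.
move=> tn HR l p.
set a := (fun k : 'I_n => _ : bool); have [S F] := radj_layer a t (R l).
have disj (k k' : 'I_n) : swapped n t k -> swapped n t k' -> k' != k ->
    k != next k'.
  by move=> sk sk' kk; case: (box_disjoint sk' sk kk).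
(* A wire to the left of another stays there unless the two are exchanged. *)
have moved (p1 p' : 'I_n) : (p' < p1)%N -> ~~ swapped n t p' || (p1 != next p') ->
    lab n t p' = l -> exists2 p'' : 'I_n, (p'' < mvo t p1)%N & lab n t.+1 p'' = l.
  move=> p1p ns lp; exists (mvo t p'); last by rewrite lab_mvo.
  apply: mv_lt => //; rewrite -?implybE; apply: contraL ns => /andP[sp e].
  rewrite negb_or negbK sp negbK -val_eqE /= val_next //.
  by case/andP: sp.
have [sp mvp|k sk pk mvp|sp pn mvp] := posP t p.
- have [r1 r2] := S p sp; have [l1 l2 l3] := lab_next tn sp.
  rewrite r1 l1; split.
    move=> lq; have -> : R l (next p) by case: (HR l (next p)) => H _; apply: H.
    case: (boolP (R l p)) => Rp; last by rewrite andbF.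
    by case: (HR l p) => _ /(_ Rp)[e|[lt _]];
      [clear -e lq l3 | clear -lt lq l3]; lia.
  (* If l is the wire leaving p to the right, the choice of [a] makes its coefficient at the new
     occupant of p vanish. *)
  case: (eqVneq (lab n t p) l) => [lp|lp] Rq.
    have Rp : R l p by case: (HR l p) => H _; apply: H.
    by move: Rq; rewrite /a lp Rp andbT addbb.
  have : lab n t (next p) = l \/ (l < lab n t (next p))%N /\
      exists2 p' : 'I_n, (p' < p)%N & lab n t p' = l.
    case: (boolP (R l (next p))) => Rn.
      case: (HR l (next p)) => _ /(_ Rn)[|[lt [p' p'q lp']]]; [by left | right].
      split=> //; exists p' => //; rewrite ltn_neqAle.
      rewrite -ltnS -(val_next (k := p)) ?p'q ?andbT; last by case/andP: sp.
      by apply: contraNneq lp => /val_inj <-; apply/eqP.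
    have Rp : R l p.
      by move: Rq; rewrite (negPf Rn); case: (R l p); rewrite ?andbF.
    case: (HR l p) => _ /(_ Rp)[e|[lt H]]; first by rewrite e eqxx in lp.
    by right; split=> //; apply: ltn_trans l3.
  case=> [|[lt [p' p'p lp']]]; [by left | right; split=> //].
  have [|p'' lt'' e''] := moved p p' p'p _ lp'.
    case: (boolP (swapped n t p')) => //= sp'.
    by apply: disj sp sp' _; rewrite neq_ltn p'p.
  exists p'' => //; move: lt''; rewrite mvp val_next; last by case/andP: sp.
  rewrite ltnS leq_eqVlt => /orP[/eqP/val_inj e|//].
  by move: lt; rewrite -e'' e l1 ltnn.
(* The wire arriving at p from the left keeps its coefficient. *)
- have [r1 r2] := S k sk; have [l1 l2 l3] := lab_next tn sk.
  rewrite pk r2 l2; split; first by case: (HR l k).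
  case: (HR l k) => _ H /H[->|[lt [p' p'k lp']]]; [by left | right; split=> //].
  have [|p'' lt'' e''] := moved k p' p'k _ lp'.
    case: (boolP (swapped n t p')) => //= sp'.
    by apply: disj sk sp' _; rewrite neq_ltn p'k.
  exists p'' => //; rewrite -(_ : mvo t k = next k) //; apply: val_inj.
  by rewrite /= /mv sk val_next //; case/andP: sk.
- have lp1 : lab n t.+1 p = lab n t p by rewrite -(lab_mvo p tn) mvp.
  rewrite F // lp1; split; first by case: (HR l p).
  case: (HR l p) => _ H /H[->|[lt [p' p'p lp']]]; [by left | right; split=> //].
  have [|p'' lt'' e''] := moved p p' p'p _ lp'.
    by case: (boolP (swapped n t p')) => //= /pn.
  by rewrite mvp in lt''; exists p''.
Qed.

(** A box changes only the coefficient of its wire of larger label, by a multiple of that of the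
    smaller one. In label order this is unitriangular, so the least label in the support is
    preserved. *)
Lemma leading_step t a p c : (t < n)%N ->
  leading t.+1 (mvo t p) (radj (layer a t) c) -> leading t p c.
Proof.
move=> tn; rewrite /leading lab_mvo // => -[cp cl].
have [S F] := radj_layer a t c.
have cS k : swapped n t k -> radj (layer a t) c k = c (next k) (+) (a k && c k).
  by move=> sk; case: (S k sk).
have cN k : swapped n t k -> radj (layer a t) c (next k) = c k.
  by move=> sk; case: (S k sk).
split.
  have [sp mvp|k sk pk mvp|sp pn mvp] := posP t p; rewrite mvp in cp.
  - by rewrite -(cN p sp).
  - have [l1 l2 l3] := lab_next tn sk.
    move: cp; rewrite cS // -pk; case: (c p) => //=.
    case: (boolP (c k)) => ck; last by rewrite andbF.
    move: (cl (next k)); rewrite cN // ck l2 pk => /(_ isT).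
    by clear -l3; lia.
  - by rewrite -F.
move=> p' cp'; have [sp mvp|k sk pk mvp|sp pn mvp] := posP t p'.
- have [l1 l2 l3] := lab_next tn sp.
  by rewrite -l2; apply: cl; rewrite cN.
- have [l1 l2 l3] := lab_next tn sk.
  rewrite pk; case: (boolP (c k)) => ck.
    by apply: leq_trans (ltnW l3); rewrite -l2; apply: cl; rewrite cN.
  by rewrite -l1; apply: cl; rewrite cS // -pk cp' (negPf ck) andbF.
- by rewrite -(lab_mvo p' tn) mvp; apply: cl; rewrite F.
Qed.

(** Induction on the number d of remaining layers. A pair not yet crossed either meets in the
    present layer, where unit functionals serve, or meets later, and its functionals are pulled back
    through the layer. *)
Lemma brick d t R : (t + d = n)%N -> unmet_rows t R -> exists ps,
  [/\ all (fun p : 'I_n * 'I_n => adjacent p.1 p.2) ps,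
     (forall T (tt : 'I_n -> nat), (forall q, tt q <= T)%N ->
        forall q, (finish ps tt q <= T + 3 * d)%N),
     (forall x p, run ps x p = dot (R (lab n n p)) x) &
     forall p q, (p < q)%N -> (lab n t p < lab n t q)%N -> exists b c,
       [/\ leading t p b, leading t q c &
        insertable ps (fun x => (-1) ^+ (dot b x && dot c x) : C)]].
Proof.
elim: d t R => [|d IH] t R.
  rewrite addn0 => -> HR; exists [::]; split=> //.
  - by move=> T tt tT q; rewrite addn0.
  (* At time n the labels are reversed: no larger label stands to the right of l, so row l reduces
     to wire l itself. *)
  - move=> x p; rewrite /run /=; have -> : R (lab n n p) = unit_bits p.
      apply/ffunP => p'; rewrite ffunE; case: (HR (lab n n p) p') => H1 H2.
      apply/idP/eqP => [/H2|->]; last by case: (HR (lab n n p) p) => ->.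
      have ltp := ltn_ord p; have ltp' := ltn_ord p'.
      rewrite !lab_end // => -[e|[lt [p3 p3p]]].
        by apply: val_inj => /=; clear -e ltp ltp'; lia.
      have ltp3 := ltn_ord p3; rewrite lab_end //.
      by clear -lt p3p ltp ltp' ltp3; lia.
    by rewrite dotC dot_unit.
  - by move=> p q pq; rewrite !lab_end //; clear -pq; lia.
move=> td HR; have tn : (t < n)%N by clear -td; lia.
pose a k := R (lab n t k) (next k).
have td' : (t.+1 + d = n)%N by rewrite addSnnS.
have [ps [adj tm rn pr]] := IH _ _ td' (unmet_rows_step tn HR).
have dis := adjacent_distinct (layer_adjacent a t).
exists (layer a t ++ ps); split.
- by rewrite all_cat layer_adjacent.
- move=> T tt tT q; rewrite finish_cat mulnS addnA.
  exact: tm (finish_layer a t tT) q.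
- by move=> x p; rewrite run_cat rn dot_radj.
move=> p q pq lpq.
case: (boolP (swapped n t p && (q == next p))) => [/andP[sp /eqP qp]|npq].
  exists (unit_bits p), (unit_bits q); split.
  - by split=> [|p']; rewrite ffunE // => /eqP ->.
  - by split=> [|p']; rewrite ffunE // => /eqP ->.
  apply: insertable_catl; rewrite qp.
  apply: eq_insertable (insertable_boxes C a (layer_uniq t) (layer_all t)
    (k := p) _) => [x|]; last by rewrite mem_layer.
  by rewrite ![dot (unit_bits _) x]dotC !dot_unit.
have mpq : (mvo t p < mvo t q)%N.
  apply: mv_lt => //; apply: contra npq => /andP[sp e]; rewrite sp /=.
  by rewrite -val_eqE /= val_next //; case/andP: sp.
have [|b' [c' [lb lc rbc]]] := pr _ _ mpq; first by rewrite !lab_mvo.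
have [b eb] := radj_surj b' dis; have [c ec] := radj_surj c' dis.
exists b, c; split.
- by apply: (leading_step (a := a)) => //; rewrite eb.
- by apply: (leading_step (a := a)) => //; rewrite ec.
apply: eq_insertable (insertable_catr (layer a t) rbc) => x.
by rewrite -eb -ec !dot_radj.
Qed.

Lemma stage2 (b : 'I_n -> bits n) : (forall i : 'I_n, anti_tri i (b i)) ->
  exists ps,
  [/\ all (fun p : 'I_n * 'I_n => adjacent p.1 p.2) ps,
     (forall T (tt : 'I_n -> nat), (forall q, tt q <= T)%N ->
        forall q, (finish ps tt q <= T + 3 * n)%N),
     (forall x, run ps x = [ffun i => dot (b i) x]) &
     forall p q, insertable ps (fun x => (-1) ^+ (x p && x q) : C)].
Proof.
move=> tri.
(* Wire l ends at position n - 1 - l, hence the reversal; with the value 0, labels out of range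
   satisfy [unmet_rows] trivially. *)
pose R (l : nat) : bits n :=
  if insub l is Some i then b (rev_ord i) else 0.
have RE (l : nat) (ln : (l < n)%N) :
    exists2 i : 'I_n, i = (n - l.+1)%N :> nat & R l = b i.
  by rewrite /R insubT; exists (rev_ord (Ordinal ln)).
have HR : unmet_rows 0 R.
  move=> l p; rewrite lab0 //; split.
    move=> pl; have ln : (l < n)%N by rewrite -pl.
    have [i ei ->] := RE l ln.
    by case: (tri i) => _; apply; have := ltn_ord p; clear -ei pl; lia.
  case: (ltnP l n) => ln; last first.
    by rewrite /R insubF ?bits0 // ltnNge ln.
  have [i ei ->] := RE l ln; case: (tri i) => z _ bp.
  have lp : (l <= p)%N.
    rewrite leqNgt; apply/negP => pl; move: bp; rewrite z //.
    by clear -ei ln pl; lia.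
  case: (eqVneq l p) => [->|lnp]; [by left | right; split].
    by rewrite ltn_neqAle lnp.
  by exists (Ordinal ln); [rewrite ltn_neqAle lnp | rewrite lab0].
have [ps [adj tm rn pr]] := brick (add0n n) HR.
exists ps; split=> //.
  move=> x; apply/ffunP => p; rewrite ffunE rn lab_end //.
  have ltp := ltn_ord p.
  have [|i ei ->] := RE (n - p.+1)%N; first by clear -ltp; lia.
  by rewrite (_ : i = p) //; apply: val_inj => /=; clear -ltp ei; lia.
apply: insertable_quadratic => p q pq.
have [|a [c [[ap al] [cq cl] H]]] := pr p q pq; first by rewrite !lab0.
exists a, c; split=> //; split=> // k; first by move/al; rewrite !lab0.
by move/cl; rewrite !lab0.
Qed.

End Brick.

(** * The circuit for a Clifford transformation *)

Section Assembly.

Local Open Scope ring_scope.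

Variables (C : numClosedFieldType) (n : nat).
Implicit Types (s w : seq (gen n)) (x y z a : bits n) (k q : 'I_n).

Definition trunc (j : nat) x : bits n := [ffun k : 'I_n => (k < j)%N && x k].

Lemma trunc0 x : trunc 0 x = 0.
Proof. by apply/ffunP => k; rewrite !ffunE. Qed.

Lemma trunc_full x : trunc n x = x.
Proof. by apply/ffunP => k; rewrite ffunE ltn_ord. Qed.

Lemma truncS (j : nat) (jn : (j < n)%N) x : trunc j.+1 x =
  if x (Ordinal jn) then trunc j x + unit_bits (Ordinal jn) else trunc j x.
Proof.
apply/ffunP => k; rewrite ffunE ltnS leq_eqVlt.
case: (eqVneq (k : nat) j) => [kj|kj].
  have -> : k = Ordinal jn by exact: val_inj.
  by case: ifP => xk; rewrite ?bitsD !ffunE /= ltnn ?eqxx ?xk.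
have kj' : (k == Ordinal jn) = false by rewrite -val_eqE /=; exact: negbTE.
by case: ifP => _; rewrite ?bitsD !ffunE /= ?kj' ?addbF.
Qed.

(** Build x from 0 one bit at a time in index order: setting bit k contributes a power of i and
    signs (-1)^(x_k x_q) for some q < k, all of them insertable. *)
Lemma insertable_phase ps (phi : bits n -> C) :
  (forall k, exists p d, forall x,
     phi (x + unit_bits k) = phi x * ('i ^+ p * (-1) ^+ dot d x)) ->
  (forall k q, insertable ps (fun x => (-1) ^+ (x k && x q) : C)) ->
  exists psi, insertable ps psi /\ forall x, phi x = phi 0 * psi x.
Proof.
move=> step quad.
suff H j : (j <= n)%N -> exists psi, insertable ps psi /\
    forall x, phi (trunc j x) = phi 0 * psi x.
  have [psi [ins e]] := H n (leqnn n).
  by exists psi; split=> // x; rewrite -e trunc_full.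
elim: j => [|j IH] jn.
  by exists (fun=> 1); split=> [|x]; [exact: insertable1 | rewrite trunc0 mulr1].
have [psi [ins e]] := IH (ltnW jn); pose k := Ordinal jn.
have [p [d pd]] := step k.
exists (fun x => psi x * ('i ^+ (p * x k) *
   \prod_q (-1) ^+ [&& d q, (q < j)%N, x k & x q])); split.
  apply: insertableM ins _; apply: insertableM; first exact: insertable_wire.
  apply: insertable_prod => q _.
  case: (d q); last exact: insertable1.
  case: (q < j)%N; last exact: insertable1.
  exact: quad.
move=> x; rewrite truncS -/k mulrA -e; case: (boolP (x k)) => xk.
  rewrite pd muln1 /dot sign_sum; congr (_ * (_ * _)).
  by apply: eq_bigr => q _; rewrite ffunE.
rewrite muln0 mul1r big1 ?mulr1 // => q _.
by rewrite !andbF.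
Qed.

Lemma pauli_X (a : bits n) : exists s,
  [/\ all lnn s, cnots s = [::] &
   exists p, eval C s = 'i ^+ p *: pauli_op C (a, 0)].
Proof.
suff H j : (j <= n)%N -> exists s, [/\ all lnn s, cnots s = [::] &
   exists p, eval C s = 'i ^+ p *: pauli_op C (trunc j a, 0)].
  by have := H n (leqnn n); rewrite trunc_full.
elim: j => [|j IH] jn.
  exists [::]; split=> //; exists 0%N.
  by rewrite trunc0 expr0 scale1r -[(0, 0)]/(0 : pauli n) pauli_op0.
have [s [ls cs [p e]]] := IH (ltnW jn); pose k := Ordinal jn.
rewrite truncS -/k; case: (a k); last by exists s; split=> //; exists p.
(* H P P H = H Z H is X on qubit k. *)
exists (s ++ [:: GH k; GP k; GP k; GH k]); split.
- by rewrite all_cat ls.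
- by rewrite cnots_cat cs.
have [p' e'] := gop_pauli C (0, unit_bits k) (isT : wf_gen (GH k)).
have gE : gact (GH k) (0, unit_bits k) = (unit_bits k, 0).
  by congr pair; apply/ffunP => q; rewrite !ffunE; case: eqP.
have X_eq : eval C [:: GH k; GP k; GP k; GH k] =
    'i ^+ p' *: pauli_op C (unit_bits k, 0).
  rewrite [eval C _]/= mul1mx -!mulmxA (mulmxA (gop C (GP k)) (gop C (GP k))).
  by rewrite gopPP mulmxA e' gE -scalemxAl -mulmxA gopHK mulmx1.
exists (p' + p)%N; rewrite eval_cat e X_eq -scalemxAl -scalemxAr scalerA -exprD.
congr (_ *: _); apply: eq_entry => x y.
rewrite entry_mul_pauli !entry_pauli /= !dot0l expr0 mulr1.
by rewrite addrA.
Qed.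

(** Column 0 of r is a common eigenvector of all Z_i, hence a multiple of a single basis state t0;
    conjugating X operators through r then determines the other columns. *)
Lemma monomial_form w (b : 'I_n -> bits n) : all wf_gen w ->
  (forall i, act w (0, b i) = (0, unit_bits i)) ->
  exists (t0 : bits n) (phi : bits n -> C), phi 0 != 0 /\
   [/\ forall x y, entry (eval C w) x y =
        phi y *+ (x == t0 + [ffun i => dot (b i) y]) &
      forall k, exists p d, forall x,
        phi (x + unit_bits k) = phi x * ('i ^+ p * (-1) ^+ dot d x)].
Proof.
move=> ww wb; set r := eval C w; pose A y : bits n := [ffun i => dot (b i) y].
have AD x y : A (x + y) = A x + A y.
  by apply/ffunP => i; rewrite bitsD !ffunE dotDr.
have [t0 t0P] : exists t0, entry r t0 0 != 0.
  apply/existsP; rewrite -[X in is_true X]negbK negb_exists.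
  apply/negP => /forallP r0.
  have := congr1 (fun M => entry M 0 0) (mulVmx (eval_unit C ww)).
  rewrite /= entryM entry1 eqxx big1 => [|z _].
    by move/eqP; rewrite eq_sym oner_eq0.
  by move: (r0 z); rewrite negbK => /eqP ->; rewrite mulr0.
(* Every nonzero entry of column 0 satisfies the same eigenvalue equation for Z_i, which fixes its
   bit i. *)
have r0 x : entry r x 0 != 0 -> x = t0.
  move=> xP; apply/ffunP => i; have [p e] := eval_pauli C (0, b i) ww.
  have H y : entry r y 0 != 0 -> 'i ^+ p * (-1) ^+ y i = 1 :> C.
    move=> yP; have := congr1 (fun M => entry M y 0) e.
    rewrite /= wb entryZ entry_mul_pauli entry_pauli_mul /= !addr0 dot0 mulr1.
    rewrite dotC dot_unit mulrA -/r => {}e.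
    by apply: (mulIf yP); rewrite mul1r -e.
  have ip : 'i ^+ p != 0 :> C by rewrite expf_neq0 // neq0Ci.
  apply: (@signr_inj C); apply: (mulfI ip).
  exact: etrans (H x xP) (esym (H t0 t0P)).
(* The X part is read off by pairing with Z_i, the image of [b i], since the action preserves
   [sympl]. *)
have actA y : (act w (y, 0)).1 = A y.
  apply/ffunP => i; have := act_sympl (y, 0) (0, b i) ww.
  by rewrite wb /sympl /= dot_unit !dot0 !addbF dotC ffunE.
pose phi y := entry r (t0 + A y) y.
have rE x y : entry r x y = phi y *+ (x == t0 + A y).
  case: (eqVneq x (t0 + A y)) => [->//|xn]; rewrite mulr0n.
  have [p e] := eval_pauli C (y, 0) ww.
  have := congr1 (fun M => entry M x 0) e.
  rewrite /= entryZ entry_mul_pauli entry_pauli_mul /= add0r dot0l mulr1 -/r.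
  rewrite actA => ->; case: (eqVneq (entry r (x + A y) 0) 0) => [->|/r0 e'].
    by rewrite !mulr0.
  by rewrite -e' bitsK eqxx in xn.
have A0 : A 0 = 0 by apply/ffunP => i; rewrite !ffunE dot0.
exists t0, phi; split; first by rewrite /phi A0 addr0.
split=> // k.
have [p e] := eval_pauli C (unit_bits k, 0) ww.
pose v2 := (act w (unit_bits k, 0)).2.
(* The sign (-1)^(v2 . (t0 + A x)) splits into a constant, absorbed in the power of i, and the
   transpose of A applied to v2. *)
exists (p + 2 * dot v2 t0)%N, [ffun j => \sum_i (v2 i * b i j : bool)] => x.
have := congr1 (fun M => entry M (t0 + A (x + unit_bits k)) x) e.
rewrite /= entryZ entry_mul_pauli entry_pauli_mul /= dot0l mulr1 -/r.
have zE : t0 + A (x + unit_bits k) + A (unit_bits k) = t0 + A x.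
  by rewrite AD addrA bitsK.
rewrite actA zE -/v2 -/(phi _) -/(phi _) => ->.
rewrite dotDr signr_addb exprD exprM sqrCi.
have -> : dot v2 (A x) = dot [ffun j => \sum_i (v2 i * b i j : bool)] x.
  rewrite /dot; under eq_bigr => i _ do rewrite ffunE /dot mulr_sumr.
  rewrite exchange_big /=; apply: eq_bigr => j _; rewrite ffunE mulr_suml.
  by apply: eq_bigr => i _; rewrite mulrA.
by rewrite [RHS]mulrC !mulrA.
Qed.

Theorem clifford_lnn (U : op C n) : (0 < n)%N -> clifford U ->
  exists s : seq (lnn_gate C n),
    (two_qubit_depth s <= 7 * n - 4)%N /\
    exists c : C, `|c| = 1 /\ U = c *: circuit_op s.
Proof.
move=> n0 /clifford_eval[w ww ->]; have wi := wf_inv ww.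
pose v i := act (inv w) (0, unit_bits i).
pose u i := act (inv w) (unit_bits i, 0).
have vv i j : sympl (v i) (v j) = false.
  by rewrite act_sympl // /sympl /= dot0l dot0.
have vuE i j : sympl (v i) (u j) = (i == j).
  by rewrite act_sympl // /sympl /= dot0l dot_unit ffunE eq_sym.
have vu i : sympl (v i) (u i) = true by rewrite vuE eqxx.
have vu' i j : i != j -> sympl (v i) (u j) = false by rewrite vuE => /negPf.
have [s1 [l1 t1 [b Hb]]] := stage1 vv vu vu'.
have w1 := lnn_all_wf l1.
have [|ps [adj t2 rn quad]] := @stage2 C n b; first by move=> i; case: (Hb i).
have wr : all wf_gen (inv s1 ++ w) by rewrite all_cat wf_inv.
have [|t0 [phi [phi0 [rE step]]]] := monomial_form (b := b) wr.
  move=> i; rewrite act_cat -(Hb i).1 act_inv // /v.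
  by rewrite act_invr.
have [psi [ins ephi]] := insertable_phase step quad.
have [s2 [l2 c2 e2]] := insertable_word ins adj.
have [s3 [l3 c3 [p e3]]] := pauli_X t0.
pose s := s1 ++ s2 ++ s3.
have ls : all lnn s by rewrite !all_cat l1 l2 l3.
have ip : 'i ^+ p != 0 :> C by rewrite expf_neq0 // neq0Ci.
(* What remains after [s1] is monomial: [s2] gives the linear map with its phases, [s3] the
   translation by t0. *)
have r_eq : eval C (inv s1 ++ w) =
    (phi 0 * ('i ^+ p)^-1) *: eval C (s2 ++ s3).
  apply: eq_entry => x y.
  rewrite rE entryZ eval_cat e3 -scalemxAl entryZ entry_pauli_mul /= dot0l.
  rewrite e2 rn mul1r mulrA mulfVK // ephi mulrnAr.
  congr (_ *+ nat_of_bool _); apply/eqP/eqP => [->|<-].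
    by rewrite (addrC t0) bitsK.
  by rewrite addrC bitsK.
have eU : eval C w = (phi 0 * ('i ^+ p)^-1) *: eval C s.
  rewrite /s eval_cat scalemxAl -r_eq eval_cat -mulmxA eval_inv //.
  by rewrite mulmx1.
have [s' [es qs]] := lnn_circuit C ls.
exists s'; split.
  apply: depth_le qs _ => q.
  rewrite !cnots_cat c2 c3 cats0 finish_cat.
  (* The second stage starts with all qubits free at 4n - 4 and lasts 3n. *)
  apply: leq_trans (t2 _ _ t1 q) _; clear -n0; lia.
exists (phi 0 * ('i ^+ p)^-1); rewrite es; split=> //.
exact: (norm_global_phase ww (lnn_all_wf ls) eU).
Qed.

End Assembly.

Theorem lemma4 (R : realType) (n : nat) (hn : 0 < n)
    (U : op R[i] n) (hU : clifford U) :
  exists s : seq (lnn_gate R[i] n),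
    two_qubit_depth s <= 7 * n - 4 /\
    exists c : R[i], (`|c| = 1 /\ U = c *: circuit_op s)%R.
Proof. exact: clifford_lnn. Qed.
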